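(* Let $(\mathcal X,d,\mu)$ be a space of homogeneous type with upper dimension $\omega$ and $\mu(\mathcal X)=\infty$, let $\{Q_k\}_{k\in\mathbb Z}$ be an exp-ATI on $\mathcal X$ with smoothness index $\eta\in(0,1)$, let $\beta,\gamma\in(0,\eta)$, and let $s\in(0,\beta\wedge\gamma)$. (i) If $p\in(\omega/[\omega+(\beta\wedge\gamma)],\infty]$ and $q\in(0,\infty]$, then $\dot L_b(s,p,q;\mathcal X)\subset\dot B^s_{p,q}(\mathcal X)$. (ii) If $p,q\in(\omega/[\omega+(\beta\wedge\gamma)],\infty]$, then $\dot L_t(s,p,q;\mathcal X)\subset\dot F^s_{p,q}(\mathcal X)$.
   Context: **Space.** A quasi-metric $d$ on a non-empty set $\mathcal X$ is a function $d:\mathcal X\times\mathcal X\to[0,\infty)$ with $d(x,y)=0\iff x=y$, $d(x,y)=d(y,x)$ and $d(x,z)\le A_0[d(x,y)+d(y,z)]$ for all $x,y,z$, for some constant $A_0\in[1,\infty)$. $B(x,r):=\{y: d(x,y)<r\}$. $(\mathcal X,d,\mu)$ is a space of homogeneous type if $\mu$ is a measure for which balls are measurable with measure in $(0,\infty)$ and there is $C_{(\mu)}\in[1,\infty)$ with $\mu(B(x,2r))\le C_{(\mu)}\mu(B(x,r))$ for all $x,r$; $\omega:=\log_2C_{(\mu)}$ is the upper dimension. Notation: $V_r(x):=\mu(B(x,r))$, $V(x,y):=\mu(B(x,d(x,y)))$ (so $V(x,x)=0$), $a\wedge b:=\min\{a,b\}$. **Dyadic system.** Fix $0<c_0\le C_0<\infty$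 and $\delta$ with $0<\delta\le(2A_0)^{-10}$, $12A_0^3C_0\delta\le c_0$, and points $\{z^k_\alpha:k\in\mathbb Z,\alpha\in\mathcal A_k\}\subset\mathcal X$ such that, for each $k$, $d(z^k_\alpha,z^k_\beta)\ge c_0\delta^k$ if $\alpha\ne\beta$, and $\min_{\alpha\in\mathcal A_k}d(x,z_\alpha^k)<C_0\delta^k$ for all $x$. Fix an associated system of dyadic cubes $\{Q^k_\alpha\}$: for each $k$ the sets $Q_\alpha^k$ ($\alpha\in\mathcal A_k$) are disjoint with union $\mathcal X$; if $k\le l$ then either $Q^l_\beta\subset Q^k_\alpha$ or $Q^l_\beta\cap Q^k_\alpha=\emptyset$; and $B(z^k_\alpha,(3A_0^2)^{-1}c_0\delta^k)\subset Q^k_\alpha\subset B(z^k_\alpha,2A_0C_0\delta^k)$. Put $\mathcal G_k:=\mathcal A_{k+1}\setminus\mathcal A_k$, $\mathcal Y^k:=\{z_\alpha^{k+1}\}_{\alpha\in\mathcal G_k}$, $d(x,\mathcal Y^k):=\inf_{y\in\mathcal Y^k}d(x,y)$. **exp-ATI.** A sequence $\{Q_k\}_{k\in\mathbb Z}$ of bounded linear integral operators on $L^2(\mathcal X)$ (kernels also denoted $Q_k(x,y)$) is an exp-ATI (approximation of the identity with exponential decay) with smoothness index $\eta\in(0,1)$ if there are $C,\nu\in(0,\infty)$ and $a\in(0,1]$ such that, writing $$E_k(x,y):=\frac{1}{\sqrt{V_{\delta^k}(x)V_{\delta^k}(y)}}\exp\Big\{-\nu\Big[\frac{d(x,y)}{\delta^k}\Big]^a\Big\}\exp\Big\{-\nu\Big[\frac{\max\{d(x,\mathcal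 Y^k),d(y,\mathcal Y^k)\}}{\delta^k}\Big]^a\Big\},$$ for all $k\in\mathbb Z$: (i) $\sum_{k=-\infty}^\infty Q_k=I$ in $L^2(\mathcal X)$; (ii) $|Q_k(x,y)|\le CE_k(x,y)$ for all $x,y$; (iii) if $d(x,x')\le\delta^k$, then $|Q_k(x,y)-Q_k(x',y)|+|Q_k(y,x)-Q_k(y,x')|\le C[d(x,x')/\delta^k]^\eta E_k(x,y)$; (iv) if $d(x,x')\le\delta^k$ and $d(y,y')\le\delta^k$, then $|[Q_k(x,y)-Q_k(x',y)]-[Q_k(x,y')-Q_k(x',y')]|\le C[d(x,x')/\delta^k]^\eta[d(y,y')/\delta^k]^\eta E_k(x,y)$; (v) $\int_{\mathcal X}Q_k(x,y')\,d\mu(y')=0=\int_{\mathcal X}Q_k(x',y)\,d\mu(x')$ for all $x,y$. **Test functions and distributions.** For $x_1\in\mathcal X$, $r\in(0,\infty)$, $\beta\in(0,1]$, $\gamma\in(0,\infty)$, $\mathcal G(x_1,r,\beta,\gamma)$ is the set of measurable $f$ for which there is $C$ with (a) $|f(x)|\le C\frac1{V_r(x_1)+V(x_1,x)}[\frac r{r+d(x_1,x)}]^\gamma$ for all $x$; (b) $|f(x)-f(y)|\le C[\frac{d(x,y)}{r+d(x_1,x)}]^\beta\frac1{V_r(x_1)+V(x_1,x)}[\frac r{r+d(x_1,x)}]^\gamma$ whenever $d(x,y)\le(2A_0)^{-1}[r+d(x_1,x)]$; its norm is the infimum of such $C$. Fix $x_0\in\mathcal X$, $r_0\in(0,\infty)$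 and set $\mathcal G(\beta,\gamma):=\mathcal G(x_0,r_0,\beta,\gamma)$ (independent of the choice up to equivalent norms), $\mathring{\mathcal G}(\beta,\gamma):=\{f\in\mathcal G(\beta,\gamma):\int f\,d\mu=0\}$ with the same norm. For $\beta,\gamma\in(0,\eta]$, $\mathring{\mathcal G}_0^\eta(\beta,\gamma)$ is the completion of $\mathring{\mathcal G}(\eta,\eta)$ in $\mathring{\mathcal G}(\beta,\gamma)$, and $(\mathring{\mathcal G}_0^\eta(\beta,\gamma))'$ is its dual with the weak-$*$ topology. For $f$ in this dual, $Q_kf(x)=Q_k(f)(x):=\langle f,Q_k(x,\cdot)\rangle$. **Besov and Triebel–Lizorkin spaces** (independent of the choice of $\beta,\gamma$ and the exp-ATI). With $\eta,\beta,\gamma,s$ as in the claim: for $p\in(\omega/[\omega+(\beta\wedge\gamma)],\infty]$ and $q\in(0,\infty]$, $\dot B^s_{p,q}(\mathcal X)$ is the set of $f\in(\mathring{\mathcal G}_0^\eta(\beta,\gamma))'$ with $$\|f\|_{\dot B^s_{p,q}(\mathcal X)}:=\Big[\sum_{k\in\mathbb Z}\delta^{-ksq}\|Q_kf\|_{L^p(\mathcal X)}^q\Big]^{1/q}<\infty;$$ for $p\in(\omega/[\omega+(\beta\wedge\gamma)],\infty)$ and $q\in(\omega/[\omega+(\beta\wedge\gamma)],\infty]$, $\dot F^s_{p,q}(\mathcal X)$ is the set of such $f$ with $$\|f\|_{\dot F^s_{p,q}(\mathcal X)}:=\Big\|\Big[\sum_{k\in\mathbb Z}\delta^{-ksq}|Q_kf|^q\Big]^{1/q}\Big\|_{L^p(\mathcal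 X)}<\infty;$$ for $q\in(\omega/[\omega+(\beta\wedge\gamma)],\infty]$, $\dot F^s_{\infty,q}(\mathcal X)$ is the set of such $f$ with $$\|f\|_{\dot F^s_{\infty,q}(\mathcal X)}:=\sup_{l\in\mathbb Z}\sup_{\alpha\in\mathcal A_l}\Big[\frac1{\mu(Q^l_\alpha)}\int_{Q^l_\alpha}\sum_{k=l}^\infty\delta^{-ksq}|Q_kf(x)|^q\,d\mu(x)\Big]^{1/q}<\infty.$$ Usual modifications when $q=\infty$: sums over $k$ are replaced by suprema of $\delta^{-ks}(\cdots)$, and the bracket in $\dot F^s_{\infty,\infty}$ by the essential supremum over $x\in Q_\alpha^l$ of $\sup_{k\ge l}\delta^{-ks}|Q_kf(x)|$. **Lipschitz-type spaces.** $L^1_{\rm loc}(\mathcal X)$ is the set of measurable $f$ such that every $x\in\mathcal X$ has some $r>0$ with $\|f\|_{L^1(B(x,r))}<\infty$. Fix a constant $\widetilde C\in(0,\infty)$ and write $B_k(x):=B(x,\widetilde C\delta^k)$. For $s\in(0,\infty)$, $p,q\in(0,\infty]$: - $\dot L_b(s,p,q;\mathcal X)$: all $f\in L^1_{\rm loc}(\mathcal X)$ with finite $\|f\|:=\big(\sum_{k\in\mathbb Z}\delta^{-ksq}\big\{\int_{\mathcal X}\big[\frac1{\mu(B_k(x))}\int_{B_k(x)}|f(x)-f(y)|\,d\mu(y)\big]^p\,d\mu(x)\big\}^{q/p}\big)^{1/q}$; - $\dot L_t(s,p,q;\mathcal X)$: all $f\in L^1_{\rm loc}(\mathcal X)$ with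 finite $\|f\|:=\big\|\big\{\sum_{k\in\mathbb Z}\delta^{-ksq}\big[\frac1{\mu(B_k(\cdot))}\int_{B_k(\cdot)}|f(\cdot)-f(y)|\,d\mu(y)\big]^q\big\}^{1/q}\big\|_{L^p(\mathcal X)}$. Usual modifications (essential supremum in $x$ when $p=\infty$; supremum over $k$ when $q=\infty$). **Identification.** A function $f$ is identified with the distribution $g\mapsto\int_{\mathcal X}fg\,d\mu$, $g\in\mathring{\mathcal G}_0^\eta(\beta,\gamma)$; in the homogeneous spaces functions differing by a constant are thus identified. *)

(* Defs.v *)
From HB Require Import structures.
From mathcomp Require Import all_boot all_order all_algebra.
From mathcomp Require Import all_classical all_reals all_analysis.
From mathcomp Require Import ess_sup_inf.
Import Order.TTheory GRing.Theory Num.Theory.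
Import numFieldNormedType.Exports.

Set Implicit Arguments.
Unset Strict Implicit.
Unset Printing Implicit Defensive.

Local Open Scope classical_set_scope.
Local Open Scope ring_scope.

(* All functions, kernels and distributions are real-valued. *)

Section homogeneous_type.
Context {R : realType} {disp : measure_display} {X : measurableType disp}.
Variables (mu : {measure set X -> \bar R}) (dist : X -> X -> R).
Implicit Types (x y : X) (r : R).

Record quasi_metric (A0 : R) : Prop := {
  quasi_metric_const_ge1 : 1 <= A0;
  quasi_metric_ge0 : forall x y, 0 <= dist x y;
  quasi_metric_eq0 : forall x y, dist x y = 0 <-> x = y;
  quasi_metric_sym : forall x y, dist x y = dist y x;
  quasi_metric_triangle :
    forall x y z, dist x z <= A0 * (dist x y + dist y z) }.

Definition qball x r : set X := [set y | dist x y < r].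

(* [A0] and [Cmu] are any admissible constants, not necessarily the best
   ones. *)
Record homogeneous_space (A0 Cmu : R) : Prop := {
  homogeneous_quasi_metric : quasi_metric A0;
  homogeneous_measurable_ball :
    forall x r, 0 < r -> measurable (qball x r);
  homogeneous_mu_ball :
    forall x r, 0 < r -> (0 < mu (qball x r) < +oo)%E;
  homogeneous_const_ge1 : 1 <= Cmu;
  homogeneous_doubling : forall x r, 0 < r ->
    (mu (qball x (2 * r)) <= Cmu%:E * mu (qball x r))%E }.

Definition upper_dim (Cmu : R) : R := ln Cmu / ln 2.

Definition vol x r : R := fine (mu (qball x r)).

End homogeneous_type.

Section dyadic.
Context {R : realType} {disp : measure_display} {X : measurableType disp}.
Context {I : Type}.
Variables (dist : X -> X -> R) (delta : R).
Variables (A : int -> set I) (z : int -> I -> X) (cube : int -> I -> set X).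

(* Only [z k a] and [cube k a] with [A k a] are meaningful. *)
Record dyadic_system (A0 c0 C0 : R) : Prop := {
  dyadic_c0_gt0 : 0 < c0;
  dyadic_c0_le : c0 <= C0;
  dyadic_delta_gt0 : 0 < delta;
  dyadic_delta_le : delta <= (2 * A0) ^- 10;
  dyadic_delta_small : 12 * A0 ^+ 3 * C0 * delta <= c0;
  dyadic_separated : forall k a b, A k a -> A k b -> a <> b ->
    c0 * delta ^ k <= dist (z k a) (z k b);
  dyadic_net : forall k x, exists2 a, A k a & dist x (z k a) < C0 * delta ^ k;
  dyadic_measurable : forall k a, A k a -> measurable (cube k a);
  dyadic_disjoint : forall k a b, A k a -> A k b -> a <> b ->
    cube k a `&` cube k b = set0;
  dyadic_cover : forall k, \bigcup_(a in A k) cube k a = [set: X];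
  dyadic_nested : forall (k l : int) a b, (k <= l)%R -> A k a -> A l b ->
    cube l b `<=` cube k a \/ cube l b `&` cube k a = set0;
  dyadic_inner : forall k a, A k a ->
    qball dist (z k a) ((3 * A0 ^+ 2)^-1 * c0 * delta ^ k) `<=` cube k a;
  dyadic_outer : forall k a, A k a ->
    cube k a `<=` qball dist (z k a) (2 * A0 * C0 * delta ^ k) }.

Definition new_points (k : int) : set X := z (k + 1) @` (A (k + 1) `\` A k).

(* Extended-real valued, so that the distance to an empty set is [+oo]. *)
Definition dist_new_points (k : int) (x : X) : \bar R :=
  ereal_inf [set (dist x y)%:E | y in new_points k].

End dyadic.

Section expATI.
Context {R : realType} {disp : measure_display} {X : measurableType disp}.
Context {I : Type}.
Variables (mu : {measure set X -> \bar R}) (dist : X -> X -> R) (delta : R).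
Variables (A : int -> set I) (z : int -> I -> X).

(* The last factor is an [expeR] in order to vanish when [new_points k] is
   empty. *)
Definition exp_bound (nu a : R) (k : int) (x y : X) : R :=
  let dY := dist_new_points dist A z k in
  (Num.sqrt (vol mu dist x (delta ^ k) * vol mu dist y (delta ^ k)))^-1
  * expR (- (nu * (dist x y / delta ^ k) `^ a))
  * fine (expeR (- (nu%:E *
      (maxe (dY x) (dY y) * ((delta ^ k)^-1)%:E) `^ a)))%E.

Definition integral_op (K : X -> X -> R) (f : X -> R) (x : X) : R :=
  \int[mu]_y (K x y * f y).

Definition L2_bounded_kernel (K : X -> X -> R) : Prop :=
  measurable_fun [set: X * X] (fun xy => K xy.1 xy.2) /\
  exists2 M : R, 0 <= M & forall f, f \in Lfun mu 2%:E ->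
    [/\ \forall x \ae mu, mu.-integrable setT (fun y => (K x y * f y)%:E),
        integral_op K f \in Lfun mu 2%:E &
        ('N[mu]_2%:E[EFin \o integral_op K f]
           <= M%:E * 'N[mu]_2%:E[EFin \o f])%E].

(* [\sum_(-M <= k <= N) Q_k f] *)
Definition partial_sum (Q : int -> X -> X -> R) (f : X -> R) (M N : nat)
    (x : X) : R :=
  \sum_(i < (M + N).+1) integral_op (Q (i%:Z - M%:Z)) f x.

Record exp_ATI_estimates (eta : R) (Q : int -> X -> X -> R) (C nu a : R) :
    Prop := {
  exp_ATI_size : forall k x y, `|Q k x y| <= C * exp_bound nu a k x y;
  exp_ATI_regularity : forall k x x' y, dist x x' <= delta ^ k ->
    `|Q k x y - Q k x' y| + `|Q k y x - Q k y x'|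
      <= C * (dist x x' / delta ^ k) `^ eta * exp_bound nu a k x y;
  exp_ATI_second_regularity : forall k x x' y y',
    dist x x' <= delta ^ k -> dist y y' <= delta ^ k ->
    `|(Q k x y - Q k x' y) - (Q k x y' - Q k x' y')|
      <= C * (dist x x' / delta ^ k) `^ eta * (dist y y' / delta ^ k) `^ eta
         * exp_bound nu a k x y }.

Record exp_ATI (eta : R) (Q : int -> X -> X -> R) : Prop := {
  exp_ATI_bounded : forall k, L2_bounded_kernel (Q k);
  exp_ATI_identity : forall f, f \in Lfun mu 2%:E ->
    forall e : R, 0 < e -> \forall M \near \oo & N \near \oo,
      ('N[mu]_2%:E[EFin \o (partial_sum Q f M N \- f)%R] < e%:E)%E;
  exp_ATI_bounds : exists C nu a : R,
    [/\ 0 < C, 0 < nu, 0 < a, a <= 1 & exp_ATI_estimates eta Q C nu a];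
  exp_ATI_cancel_r : forall k x, (\int[mu]_y (Q k x y)%:E = 0)%E;
  exp_ATI_cancel_l : forall k y, (\int[mu]_x (Q k x y)%:E = 0)%E }.

End expATI.

Section test_functions.
Context {R : realType} {disp : measure_display} {X : measurableType disp}.
Variables (mu : {measure set X -> \bar R}) (dist : X -> X -> R) (A0 : R).
Variables (x1 : X) (r : R).
Implicit Types (f g : X -> R) (b c : R).

Definition test_weight c (x : X) : R :=
  (vol mu dist x1 r + vol mu dist x1 (dist x1 x))^-1
  * (r / (r + dist x1 x)) `^ c.

Definition test_constant b c f (C : R) : Prop :=
  [/\ 0 < C,
      forall x, `|f x| <= C * test_weight c x &
      forall x y, dist x y <= (2 * A0)^-1 * (r + dist x1 x) ->
        `|f x - f y|
          <= C * (dist x y / (r + dist x1 x)) `^ b * test_weight c x].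

Definition test_fun b c : set (X -> R) :=
  [set f : X -> R | measurable_fun setT f /\ exists C, test_constant b c f C].

(* It is [+oo] outside [test_fun b c]. *)
Definition test_norm b c f : \bar R :=
  ereal_inf [set C%:E | C in test_constant b c f].

Definition test_fun0 b c : set (X -> R) :=
  [set f | test_fun b c f /\ (\int[mu]_x (f x)%:E = 0)%E].

(* The completion of [test_fun0 eta eta] in the Banach space
   [test_fun0 b c] is its closure there. *)
Definition test_closure eta b c : set (X -> R) :=
  [set f | test_fun0 b c f /\
    forall e : R, 0 < e -> exists2 g, test_fun0 eta eta g &
      (test_norm b c (f \- g)%R < e%:E)%E].

(* The bounded linear functionals on [test_closure eta b c]; the values of
   [phi] outside [test_closure eta b c] are irrelevant. *)
Definition distribution_space eta b c : set ((X -> R) -> R) :=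
  [set phi |
    (forall (t : R) g h, test_closure eta b c g -> test_closure eta b c h ->
       phi (fun x => t * g x + h x) = t * phi g + phi h) /\
    exists C : R, forall g, test_closure eta b c g ->
       (`|phi g|%:E <= C%:E * test_norm b c g)%E].

(* The functions that, identified with the distribution
   [g |-> \int f g], belong to the set [S] of distributions. *)
Definition funs_in eta b c (S : set ((X -> R) -> R)) : set (X -> R) :=
  [set f |
    (forall g, test_closure eta b c g ->
       mu.-integrable setT (fun x => (f x * g x)%:E)) /\
    S (fun g => \int[mu]_x (f x * g x))].

End test_functions.

Section weighted_lq.
Context {R : realType}.
Variables (delta s : R).
Local Open Scope ereal_scope.

Definition wlq_sum (r : R) (D : set int) (b : int -> \bar R) : \bar R :=
  \esum_(k in D) ((delta `^ (- (k%:~R * s * r)))%:E * b k `^ r).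

Definition wlq_sup (D : set int) (b : int -> \bar R) : \bar R :=
  ereal_sup [set (delta `^ (- (k%:~R * s)))%:E * b k | k in D].

(* Meant for [0 < q] (so [q != -oo]) and nonnegative [b]. *)
Definition wlq_norm (q : \bar R) (b : int -> \bar R) : \bar R :=
  match q with
  | r%:E => (wlq_sum r setT b) `^ r^-1
  | _ => wlq_sup setT b
  end.

End weighted_lq.

Section besov_triebel_lizorkin.
Context {R : realType} {disp : measure_display} {X : measurableType disp}.
Context {I : Type}.
Variables (mu : {measure set X -> \bar R}) (dist : X -> X -> R) (A0 : R).
Variables (delta : R) (A : int -> set I) (cube : int -> I -> set X).
Variables (x0 : X) (r0 eta b c : R) (Q : int -> X -> X -> R).
Implicit Types (phi : (X -> R) -> R) (s : R) (p q : \bar R).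
Local Open Scope ereal_scope.

(* [|Q_k phi (x)|], where [Q_k phi (x) = <phi, Q_k(x, .)>] *)
Definition abs_LP phi (x : X) (k : int) : \bar R := `|phi (Q k x)|%:E.

Definition besov_norm s p q phi : \bar R :=
  wlq_norm delta s q (fun k => Lnorm mu p (fun x => abs_LP phi x k)).

(* When [q = +oo], restricting by [0] outside the cube gives the essential
   supremum over the cube since the function is nonnegative and the cube has
   positive measure. *)
Definition local_F_norm s q phi (l : int) (a : I) : \bar R :=
  let ge_l := [set k : int | (l <= k)%R] in
  match q with
  | r%:E => ((fine (mu (cube l a)))^-1%:E *
      \int[mu]_(x in cube l a) wlq_sum delta s r ge_l (abs_LP phi x)) `^ r^-1
  | _ => ess_sup mu
      ((fun x => wlq_sup delta s ge_l (abs_LP phi x)) \_ (cube l a))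
  end.

Definition triebel_lizorkin_norm s p q phi : \bar R :=
  if p == +oo then
    ereal_sup [set local_F_norm s q phi la.1 la.2 | la in
                 [set la : int * I | A la.1 la.2]]
  else Lnorm mu p (fun x => wlq_norm delta s q (abs_LP phi x)).

Definition besov s p q : set ((X -> R) -> R) :=
  [set phi | distribution_space mu dist A0 x0 r0 eta b c phi /\
             besov_norm s p q phi < +oo].

Definition triebel_lizorkin s p q : set ((X -> R) -> R) :=
  [set phi | distribution_space mu dist A0 x0 r0 eta b c phi /\
             triebel_lizorkin_norm s p q phi < +oo].

End besov_triebel_lizorkin.

Section lipschitz.
Context {R : realType} {disp : measure_display} {X : measurableType disp}.
Variables (mu : {measure set X -> \bar R}) (dist : X -> X -> R).
Variables (delta Ct : R).
Implicit Types (f : X -> R) (s : R) (p q : \bar R).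
Local Open Scope ereal_scope.

Definition L1_loc : set (X -> R) :=
  [set f : X -> R | measurable_fun setT f /\
    forall x, exists2 r : R, (0 < r)%R &
      \int[mu]_(y in qball dist x r) `|f y|%:E < +oo].

Definition oscillation f (x : X) (k : int) : \bar R :=
  let B := qball dist x (Ct * delta ^ k) in
  (fine (mu B))^-1%:E * \int[mu]_(y in B) `|f x - f y|%:E.

Definition lipschitz_b s p q : set (X -> R) :=
  [set f : X -> R | L1_loc f /\
    wlq_norm delta s q (fun k => Lnorm mu p (fun x => oscillation f x k)) < +oo].

Definition lipschitz_t s p q : set (X -> R) :=
  [set f : X -> R | L1_loc f /\
    Lnorm mu p (fun x => wlq_norm delta s q (oscillation f x)) < +oo].

End lipschitz.

(* Main.v *)
Require Import Defs.
From HB Require Import structures.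
From mathcomp Require Import all_boot all_order all_algebra.
From mathcomp Require Import all_classical all_reals all_analysis.
From mathcomp Require Import ess_sup_inf measurable_realfun lra ring.
Import Order.TTheory GRing.Theory Num.Theory.
Import numFieldNormedType.Exports.
Local Open Scope classical_set_scope.
Local Open Scope ring_scope.

Set Implicit Arguments.
Unset Strict Implicit.
Unset Printing Implicit Defensive.

(* By cancellation [Q_k f (x)] is the integral of [(f(y) - f(x)) Q_k(x,y)];
   cutting this integral along the balls [B(x, Ct delta^(k-j))], j >= 0, the
   exponential decay of [Q_k] gives, for every [rho > 0],
     |Q_k f (x)| <= sum_j C rho^j osc_f(x, k-j),
   with [osc_f] the mean oscillation of [f] over these balls. Both inclusions
   are then discrete convolution inequalities in [k], which hold for all
   exponents [p, q > 0]; for [p < infinity] in the Besov case one first replaces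
   [osc_f] by a measurable equivalent, in order to integrate the series term by
   term.
   That [f] is a distribution follows from [s < gamma]: every ball
   [B_j = B(x0, r0 delta^-j)] contains a point [x_j] where the oscillation at
   that scale is at most [C delta^(-js)]. Hence the mean of [|f - f(x_j)|] over
   [B_j] is [O(delta^(-js))], and comparing consecutive [x_j] shows that so is
   the mean of [|f - f(x_0)|]; this growth is beaten by the decay [delta^(j gamma)]
   of the test functions. *)

(** * Powers, lower integrals and [L^p] quasi-norms of functions that need not be measurable *)

Lemma lee_poweR {R : realType} (r : R) (x y : \bar R) : (0 < r)%R ->
  (0 <= x -> x <= y -> x `^ r <= y `^ r)%E.
Proof.
move=> r0 x0 xy; have y0 := le_trans x0 xy.
by apply: (gt0_ler_poweR (ltW r0)) => //; rewrite in_itv/= leey ?x0 ?y0.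
Qed.


Lemma poweRK {R : realType} (r : R) (x : \bar R) : (0 < r)%R ->
  (0 <= x -> (x `^ r) `^ r^-1 = x)%E.
Proof. by move=> r0 x0; rewrite -poweRrM mulfV ?gt_eqF// poweRe1. Qed.

Lemma poweRVK {R : realType} (r : R) (x : \bar R) : (0 < r)%R ->
  (0 <= x -> (x `^ r^-1) `^ r = x)%E.
Proof. by move=> r0 x0; rewrite -poweRrM mulVf ?gt_eqF// poweRe1. Qed.

Section lower_integral.
Local Open Scope ereal_scope.
Context {d} {T : measurableType d} {R : realType}.
Variable mu : {measure set T -> \bar R}.
Implicit Types (D : set T) (f g : T -> \bar R).

Import HBNNSimple.

(* No measurability is assumed: the integral of a nonnegative function is by
   definition a supremum over the simple functions below it. *)
Lemma ge0_le_lower_integral D f g : (forall x, D x -> 0 <= f x) ->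
  (forall x, D x -> f x <= g x) ->
  \int[mu]_(x in D) f x <= \int[mu]_(x in D) g x.
Proof.
move=> f0 fg.
have g0 x : D x -> 0 <= g x by move=> Dx; exact: le_trans (f0 _ Dx) (fg _ Dx).
rewrite !ge0_integralE//; apply: ereal_sup_le => _ [h /= hf <-]; exists h => // x.
apply: le_trans (hf x) _; rewrite /patch; case: ifPn => // /[!inE].
exact: fg.
Qed.

(** Dividing by [c] a simple function below [c f] gives a simple function below [f]. *)
Lemma lower_integralZl_le (c : R) f : (0 < c)%R -> (forall x, 0 <= f x) ->
  \int[mu]_x (c%:E * f x) <= c%:E * \int[mu]_x f x.
Proof.
move=> c0 f0.
rewrite !ge0_integralTE//; last by move=> x; rewrite mule_ge0// lee_fin ltW.
apply: ge_ereal_sup => _ [h /= hf <-].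
have ci0 : (0 <= c^-1)%R by rewrite invr_ge0 ltW.
rewrite -lee_pdivrMl// -sintegralrM.
apply: ereal_sup_ubound; exists (scale_nnsfun h ci0) => // x /=.
by rewrite EFinM lee_pdivrMl.
Qed.

(** Each simple function below [f] is measurable and a.e. at most [M] on [D], so ordinary
    monotonicity of the integral applies to it and then passes to the supremum. *)
Lemma ae_lower_integral_le D f (M : \bar R) : measurable D -> 0 <= M ->
  (forall x, D x -> 0 <= f x) ->
  (\forall x \ae mu, D x -> f x <= M) ->
  \int[mu]_(x in D) f x <= M * mu D.
Proof.
move=> mD M0 f0 fM; rewrite ge0_integralE//; apply: ge_ereal_sup => _ [h /= hf <-].
rewrite -integralT_nnsfun -(integral_cst mu mD M) (integral_mkcond D).
apply: ae_ge0_le_integral => //.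
- by move=> x _; rewrite lee_fin.
- by apply/measurable_EFinP.
- by move=> x _; rewrite erestrict_ge0.
- exact/(measurable_restrictT _ _).1.
apply: filterS fM => x fM _; apply: le_trans (hf x) _.
by rewrite /patch; case: ifPn => // /[!inE]; exact: fM.
Qed.

(** Serves for functions of [x] built from oscillations. Both the lower integral of a power and the
    essential supremum are monotone, so [p < 1] is covered as well. *)
Lemma le_Lnorm (p : \bar R) (c : R) f g : 0 < p -> (0 < c)%R ->
  (forall x, 0 <= f x) -> (forall x, 0 <= g x) ->
  (forall x, f x <= c%:E * g x) ->
  Lnorm mu p f <= c%:E * Lnorm mu p g.
Proof.
move=> p0 c0 f0 g0 fg; rewrite unlock; case: p p0 => [p|_|//].
- rewrite lte_fin => p0.
  have pi0 : (0 < p^-1)%R by rewrite invr_gt0.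
  have cp0 : (0 < c `^ p)%R by exact: powR_gt0.
  have c0' := ltW c0.
  rewrite -[c in leRHS]powRr1// -(mulfV (lt0r_neq0 p0)) powRrM -poweR_EFin.
  have I0 : 0 <= \int[mu]_x (`|g x| `^ p) by apply: integral_ge0 => x _; exact: poweR_ge0.
  rewrite -poweRM ?lee_fin ?powR_ge0//.
  apply: lee_poweR => //.
    by apply: integral_ge0 => x _; exact: poweR_ge0.
  have h0 x : 0 <= `|g x| `^ p by exact: poweR_ge0.
  apply: (le_trans _ (lower_integralZl_le cp0 h0)).
  apply: ge0_le_lower_integral => x _; first exact: poweR_ge0.
  rewrite -poweR_EFin -poweRM ?lee_fin//.
  by apply: lee_poweR; rewrite // !gee0_abs.
- case: ifPn => _; last by rewrite mule0.
  rewrite -ess_sup_pZl//; apply: le_ess_sup; apply: nearW => x /=.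
  by rewrite !gee0_abs// fg.
Qed.

(** A Chebyshev inequality that will produce the points [x_j]: for finite [p], if [f] exceeded [K t]
    on all of [B], its norm would be at least [K t v^(1/p) > t]. For [p = +oo], the exceptional null
    set cannot contain [B]. *)
Lemma exists_le_Lnorm (p : \bar R) (v : R) : 0 < p -> (0 < v)%R ->
  exists2 K : R, (0 < K)%R & forall (t : R) f B, (0 < t)%R ->
    (forall x, 0 <= f x) -> measurable B -> v%:E <= mu B ->
    Lnorm mu p f <= t%:E -> exists2 x, B x & f x <= (K * t)%:E.
Proof.
move=> p0 v0; case: p p0 => [p|_|//]; last first.
  exists 1%R => // t f B t0 f0 mB vB; rewrite unlock.
  have muB0 : 0 < mu B by exact: lt_le_trans vB.
  have muT0 : 0 < mu setT by apply: lt_le_trans muB0 _; rewrite le_measure ?inE.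
  rewrite muT0 => /ess_supP [N [mN muN0 NP]]; rewrite mul1r.
  have [x [Bx Nx]] : exists x, B x /\ ~ N x.
    apply: contrapT => /forallNP H.
    suff : mu B <= 0 by rewrite leNgt muB0.
    rewrite -muN0 le_measure ?inE// => x Bx; apply: contrapT => Nx.
    by apply: (H x).
  exists x => //; apply: contrapT => fx; apply: Nx; apply: NP => /=.
  by rewrite gee0_abs.
rewrite lte_fin => p0.
have pi0 : (0 < p^-1)%R by rewrite invr_gt0.
(* With [v^(-1/p)] alone the two sides would only balance; the factor 2 makes the contradiction
   strict. *)
exists (2 * v `^ (- p^-1))%R; first by rewrite mulr_gt0// powR_gt0.
move=> t f B t0 f0 mB vB; rewrite unlock => ft.
apply: contrapT => /forall2NP H.
set K := (2 * _)%R in H.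
have K0 : (0 < K)%R by rewrite mulr_gt0// powR_gt0.
have {}H x : B x -> (K * t)%:E <= f x.
  by move=> Bx; have [//|/negP] := H x; rewrite -ltNge => /ltW.
have I0 : 0 <= \int[mu]_x (`|f x| `^ p) by apply: integral_ge0 => x _; exact: poweR_ge0.
have {}ft : \int[mu]_x (`|f x| `^ p) <= (t `^ p)%:E.
  rewrite -[leLHS](poweRVK p0)// -poweR_EFin.
  by apply: lee_poweR => //; exact: poweR_ge0.
have : ((K * t) `^ p)%:E * mu B <= (t `^ p)%:E.
  apply: le_trans ft; rewrite -(integral_cst mu mB) (integral_mkcond B).
  apply: ge0_le_lower_integral => x _.
    by rewrite erestrict_ge0// => y _; rewrite lee_fin powR_ge0.
  rewrite /patch; case: ifPn => [/[!inE] Bx|_]; last exact: poweR_ge0.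
  rewrite -poweR_EFin; apply: lee_poweR => //.
    by rewrite lee_fin mulr_ge0// ltW.
  by rewrite gee0_abs// H.
apply/negP; rewrite -ltNge.
apply: (@lt_le_trans _ _ (((K * t) `^ p)%:E * v%:E)); last first.
  by rewrite lee_pmul2l// lte_fin powR_gt0// mulr_gt0.
have K0' := ltW K0; have t0' := ltW t0.
rewrite -EFinM lte_fin !powRM ?powR_ge0//.
rewrite -powRrM mulNr mulVf ?lt0r_neq0// powR_inv1 ?(ltW v0)//.
rewrite [ltRHS](_ : _ = 2 `^ p * t `^ p)%R; last by field; rewrite lt0r_neq0.
rewrite ltr_pMl ?powR_gt0//.
have : (1 `^ p < 2 `^ p :> R)%R by apply: gt0_ltr_powR; rewrite ?nnegrE// ltr1n.
by rewrite powR1.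
Qed.

End lower_integral.

(** * Weighted [l^q] norms and discrete convolution with a geometric sequence *)

Section tail_sup.
Local Open Scope ereal_scope.
Context {R : realType}.
Implicit Types (F G : int -> \bar R) (u : nat -> \bar R).

(** A supremum stands in for the convolution sum of [rho ^+ j] with [G]: unlike a sum, it is
    compatible with every power [r > 0], so exponents below and above 1 are treated alike. The cost
    is a doubling of [rho]. *)
Definition tail_sup (rho : R) G (k : int) : \bar R :=
  ereal_sup (range (fun j : nat => (rho ^+ j)%:E * G (k - j%:Z)%R)).

Lemma tail_sup_ge (rho : R) G k (j : nat) :
  (rho ^+ j)%:E * G (k - j%:Z)%R <= tail_sup rho G k.
Proof. by apply: ereal_sup_ubound; exists j. Qed.

Lemma nneseries_geometric (t : R) : (0 <= t < 1)%R ->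
  \sum_(j <oo) (t ^+ j)%:E = ((1 - t)^-1)%:E.
Proof.
move=> /andP[t0 t1]; apply/cvg_lim => //.
have := @cvg_geometric_series R 1 t; rewrite ger0_norm// mul1r => /(_ t1) H.
rewrite (_ : (fun n => _) = EFin \o series (geometric 1 t)%R).
  by apply: cvg_EFin => //; apply: nearW.
apply/funext => n /=; rewrite /series/= -sumEFin.
by apply: eq_bigr => i _; rewrite mul1r.
Qed.

Lemma nneseries_le_geometric (t : R) u (S : \bar R) : (0 <= t < 1)%R ->
  (forall j, 0 <= u j) -> 0 <= S -> (forall j, u j <= (t ^+ j)%:E * S) ->
  \sum_(j <oo) u j <= ((1 - t)^-1)%:E * S.
Proof.
move=> /[dup] t01 /andP[t0 t1] u0 S0 uS.
have t1' : (0 < (1 - t)^-1)%R by rewrite invr_gt0 subr_gt0.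
case: S S0 uS => [S| |//] S0 uS; last by rewrite gt0_muley ?lte_fin ?leey.
apply: le_trans (lee_nneseries _ _) _; [by move=> i _ _; exact: u0|move=> i _; exact: uS|].
rewrite (eq_eseriesr (g := fun j => S%:E * (t ^+ j)%:E)); last by move=> i _; rewrite muleC.
rewrite nneseriesZl; last by move=> i _; rewrite lee_fin exprn_ge0.
by rewrite nneseries_geometric// muleC.
Qed.

(** Each term is at most [2^-j] times the supremum, and these weights sum to 2. *)
Lemma nneseries_le_ereal_sup u : (forall j, 0 <= u j) ->
  \sum_(j <oo) u j <= 2%:E * ereal_sup (range (fun j => (2 ^+ j)%:E * u j)).
Proof.
move=> u0; set S := ereal_sup _.
have uS j : (2 ^+ j)%:E * u j <= S by apply: ereal_sup_ubound; exists j.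
have S0 : 0 <= S by apply: le_trans (uS 0%N); rewrite mule_ge0// lee_fin.
have -> : 2%:E = ((1 - 2^-1)^-1)%:E :> \bar R by congr EFin; field.
apply: nneseries_le_geometric => //; first by apply/andP; split; lra.
move=> j; rewrite exprVn lee_pdivlMl//.
Qed.

Lemma nneseries_le_tail_sup (rho c : R) G k : (0 <= rho)%R -> (0 <= c)%R ->
  (forall i, 0 <= G i) ->
  \sum_(j <oo) (c * rho ^+ j)%:E * G (k - j%:Z)%R <=
  (2 * c)%:E * tail_sup (2 * rho) G k.
Proof.
move=> rho0 c0 G0.
rewrite (eq_eseriesr (g := fun j => c%:E * ((rho ^+ j)%:E * G (k - j%:Z)%R))); last first.
  by move=> j _; rewrite muleA EFinM.
have r0 j : 0 <= (rho ^+ j)%:E * G (k - j%:Z)%R by rewrite mule_ge0// lee_fin exprn_ge0.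
rewrite nneseriesZl// mulrC EFinM -muleA lee_wpmul2l ?lee_fin//.
apply: le_trans (nneseries_le_ereal_sup r0) _.
rewrite lee_wpmul2l// /tail_sup.
by under eq_fun do rewrite muleA -EFinM -exprMn.
Qed.

(** Each [u j] is at most the [1/r]-th power of the series, hence so is the supremum. This replaces
    convexity arguments and holds for every [r > 0]. *)
Lemma poweR_ereal_sup_le u (r : R) : (0 < r)%R -> (forall j, 0 <= u j) ->
  ereal_sup (range u) `^ r <= \sum_(j <oo) u j `^ r.
Proof.
move=> r0 u0; set S := \sum_(j <oo) _.
have uS j : u j `^ r <= S.
  rewrite /S (@nneseries_split _ _ 0 j.+1)//; last by move=> *; exact: poweR_ge0.
  rewrite add0n big_nat_recr//= addeAC leeDr// adde_ge0//.
    by apply: sume_ge0 => *; exact: poweR_ge0.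
  by apply: nneseries_ge0 => *; exact: poweR_ge0.
have S0 : 0 <= S by apply: nneseries_ge0 => *; exact: poweR_ge0.
rewrite -[leRHS](poweRVK r0)//; apply: lee_poweR => //.
  by apply: (le_trans (u0 0%N)); apply: ereal_sup_ubound; exists 0%N.
apply: ge_ereal_sup => _ [j _ <-].
rewrite -[leLHS](poweRK r0)//.
by apply: lee_poweR; rewrite ?invr_gt0// poweR_ge0.
Qed.

Lemma exchange_esum_nneseries (T : choiceType) (a : T -> nat -> \bar R) :
  (forall k j, 0 <= a k j) ->
  \esum_(k in [set: T]) \sum_(j <oo) a k j =
  \sum_(j <oo) \esum_(k in [set: T]) a k j.
Proof.
move=> a0; rewrite nneseries_esumT; last by move=> j; exact: esum_ge0.
under eq_esum do rewrite nneseries_esumT//.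
rewrite !esum_esum//= (reindex_esum ([set: nat] `*`` fun=> [set: T]) _
  (fun x => (x.2, x.1)))//; split => //=.
- by move=> [i j] [k l] _ _ /= [-> ->].
- by move=> [i j] _; exists (j, i).
Qed.

Lemma esum_shift (a : int -> \bar R) (j : int) : (forall k, 0 <= a k) ->
  \esum_(k in [set: int]) a (k - j)%R = \esum_(k in [set: int]) a k.
Proof.
move=> a0; rewrite [RHS](reindex_esum [set: int] _ (fun k => k - j)%R)//.
split => //.
- by move=> k l _ _ /addIr.
- by move=> k _; exists (k + j)%R => //=; rewrite addrK.
Qed.

Lemma esumZl (T : choiceType) (D : set T) (c : R) (a : T -> \bar R) :
  (0 <= c)%R -> (forall k, 0 <= a k) ->
  \esum_(k in D) (c%:E * a k) = c%:E * \esum_(k in D) a k.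
Proof.
(* This inequality, for all constants, suffices: its instance at [c^-1] is the converse one. *)
have le (e : R) (b : T -> \bar R) : (0 <= e)%R -> (forall k, 0 <= b k) ->
    \esum_(k in D) (e%:E * b k) <= e%:E * \esum_(k in D) b k.
  move=> e0 b0; apply: ge_ereal_sup => _ [X XD <-].
  rewrite -ge0_mule_fsumr// lee_wpmul2l ?lee_fin//.
  by apply: ereal_sup_ubound; exists X.
move=> c0 a0; apply/eqP; rewrite eq_le le//=.
have [->|cn0] := eqVneq c 0%R; first by rewrite mul0e esum_ge0// => k _; rewrite mul0e.
have cp : (0 < c)%R by rewrite lt0r cn0.
rewrite -lee_pdivlMl//.
have -> : \esum_(k in D) a k = \esum_(k in D) ((c^-1)%:E * (c%:E * a k)).
  by apply: eq_esum => k _; rewrite muleA -EFinM mulVf// mul1e.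
by apply: le; rewrite ?invr_ge0// => k; rewrite mule_ge0.
Qed.

Variables (delta s : R).
Hypothesis delta_gt0 : (0 < delta)%R.

Lemma wlq_sum_ge0 (r : R) D F : 0 <= wlq_sum delta s r D F.
Proof.
by apply: esum_ge0 => k _; rewrite mule_ge0 ?poweR_ge0// lee_fin powR_ge0.
Qed.

Lemma wlq_norm_ge0 (q : \bar R) F : (forall k, 0 <= F k) ->
  0 <= wlq_norm delta s q F.
Proof.
move=> F0; have sup0 : 0 <= wlq_sup delta s setT F.
  apply: (@le_trans _ _ ((delta `^ (- (0%:~R * s)))%:E * F 0%R)).
    by rewrite mule_ge0// lee_fin powR_ge0.
  by apply: ereal_sup_ubound; exists 0%R.
by case: q => [r| |]//=; exact: poweR_ge0.
Qed.

Lemma le_wlq_norm (q : \bar R) F k : 0 < q -> (forall k, 0 <= F k) ->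
  (delta `^ (- (k%:~R * s)))%:E * F k <= wlq_norm delta s q F.
Proof.
move=> q0 F0; case: q q0 => [r|_|//]; last first.
  by apply: ereal_sup_ubound; exists k.
rewrite lte_fin => r0 /=.
have w0 : 0 <= (delta `^ (- (k%:~R * s)))%:E * F k by rewrite mule_ge0// lee_fin powR_ge0.
rewrite -[leLHS](poweRK r0)//.
apply: lee_poweR; rewrite ?invr_gt0// ?poweR_ge0//.
rewrite poweRM ?lee_fin ?powR_ge0// poweR_EFin -powRrM mulNr.
apply: esum_ge; exists [set k]; first by split.
by rewrite fsbig_set1.
Qed.

(* With [rho = delta^s / 2], the weight of the [j]th shift is [2^-j]. *)
Lemma wlq_norm_tail_sup (q : \bar R) (c : R) : 0 < q -> (0 < c)%R ->
  exists2 C : R, (0 < C)%R & forall F G,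
    (forall k, 0 <= F k) -> (forall k, 0 <= G k) ->
    (forall k, F k <= c%:E * tail_sup (delta `^ s / 2) G k) ->
    wlq_norm delta s q F <= C%:E * wlq_norm delta s q G.
Proof.
move=> q0 c0; set rho := (delta `^ s / 2)%R.
have rho0 : (0 < rho)%R by rewrite divr_gt0// powR_gt0.
have c0' := ltW c0; have rho0' := ltW rho0; have d0' := ltW delta_gt0.
have dn0 : delta != 0%R by rewrite gt_eqF.
have shift (k : int) (j : nat) :
    (delta `^ (- (k%:~R * s)) * rho ^+ j =
     2^-1 ^+ j * delta `^ (- ((k - j%:Z)%:~R * s)))%R.
  rewrite /rho exprMn mulrA mulrC; congr (_ * _)%R.
  rewrite -powR_mulrn ?powR_ge0// -powRrM -powRD; last by rewrite dn0 implybT.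
  by congr (_ `^ _)%R; rewrite rmorphB/= -pmulrn; ring.
case: q q0 => [r|_|//]; last first.
  exists c => // F G F0 G0 FG /=; apply: ge_ereal_sup => _ [k _ <-].
  have w0 : 0 <= (delta `^ (- (k%:~R * s)))%:E by rewrite lee_fin powR_ge0.
  apply: le_trans (lee_wpmul2l w0 (FG k)) _; rewrite muleCA lee_wpmul2l ?lee_fin//.
  have [->|wn0] := eqVneq (delta `^ (- (k%:~R * s)))%R 0%R.
    rewrite mul0e; exact: (@wlq_norm_ge0 +oo).
  have w0' : (0 < delta `^ (- (k%:~R * s)))%R by rewrite powR_gt0.
  rewrite -lee_pdivlMl//; apply: ge_ereal_sup => _ [j _ <-]; rewrite lee_pdivlMl//.
  rewrite muleA -EFinM shift EFinM -muleA.
  apply: (@le_trans _ _ (1%:E * ((delta `^ (- ((k - j%:Z)%:~R * s)))%:E * G (k - j%:Z)%R))).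
    rewrite lee_wpmul2r//; first by rewrite mule_ge0// lee_fin powR_ge0.
    by rewrite lee_fin exprn_ile1//; lra.
  by rewrite mul1e; apply: ereal_sup_ubound; exists (k - j%:Z)%R.
rewrite lte_fin => r0; have r0' := ltW r0.
(* The [r]-th power turns the weights [2^-j] into [t ^+ j], and [t < 1] whatever [r > 0]. The
   constant [D] is [c^r] times the sum of these weights. *)
pose t := (2^-1 `^ r)%R.
have t0 : (0 < t)%R by rewrite powR_gt0.
have t1 : (t < 1)%R.
  have : (2^-1 `^ r < 1 `^ r)%R by apply: gt0_ltr_powR; rewrite ?nnegrE//; lra.
  by rewrite powR1.
pose D := (c `^ r * (1 - t)^-1)%R.
have D0 : (0 < D)%R by rewrite mulr_gt0 ?powR_gt0// invr_gt0 subr_gt0.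
exists (D `^ r^-1)%R; first exact: powR_gt0.
move=> F G F0 G0 FG /=.
rewrite -poweR_EFin -poweRM ?lee_fin ?(ltW D0)//; last exact: wlq_sum_ge0.
apply: lee_poweR; [by rewrite invr_gt0|exact: wlq_sum_ge0|].
set w := fun k : int => (delta `^ (- (k%:~R * s * r)))%R.
pose a (k : int) := (w k)%:E * G k `^ r.
have a0 k : 0 <= a k by rewrite mule_ge0 ?poweR_ge0// lee_fin powR_ge0.
(* Once the power of the supremum is bounded by a series of powers, the two sums can be exchanged
   and each shift removed by translation invariance. *)
apply: (@le_trans _ _ (\esum_(k in [set: int]) \sum_(j <oo) (c `^ r * t ^+ j)%:E * a (k - j%:Z)%R)).
  apply: le_esum => k _.
  rewrite (eq_eseriesr (g := fun j => (c `^ r * w k)%:E *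
      (((rho ^+ j)%:E * G (k - j%:Z)%R) `^ r))); last first.
    move=> j _; rewrite poweRM ?lee_fin ?exprn_ge0// poweR_EFin /a !muleA -!EFinM.
    congr (_%:E * _); rewrite -!mulrA; congr (_ * _)%R.
    have -> : (t ^+ j = (2^-1 ^+ j) `^ r)%R.
      by rewrite /t -!powR_mulrn ?powR_ge0 ?invr_ge0// -!powRrM mulrC.
    have wE i : w i = ((delta `^ (- (i%:~R * s))) `^ r)%R by rewrite -powRrM mulNr.
    by rewrite !wE -!powRM ?powR_ge0 ?exprn_ge0 ?invr_ge0// shift.
  rewrite nneseriesZl; last by move=> *; exact: poweR_ge0.
  rewrite EFinM [_%:E * _%:E]muleC -muleA lee_wpmul2l ?lee_fin ?powR_ge0//.
  apply: (@le_trans _ _ ((c%:E * tail_sup rho G k) `^ r)); first exact: lee_poweR.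
  have ts0 : 0 <= tail_sup rho G k.
    by apply: le_trans (tail_sup_ge rho G k 0); rewrite mule_ge0// lee_fin exprn_ge0.
  rewrite poweRM// ?lee_fin// poweR_EFin lee_wpmul2l ?lee_fin ?powR_ge0//.
  apply: poweR_ereal_sup_le => // j; by rewrite mule_ge0// lee_fin exprn_ge0.
rewrite exchange_esum_nneseries; last first.
  by move=> k j; rewrite mule_ge0// lee_fin mulr_ge0 ?powR_ge0 ?exprn_ge0 ?(ltW t0).
have E j : \esum_(k in [set: int]) ((c `^ r * t ^+ j)%:E * a (k - j%:Z)%R) =
    (c `^ r * t ^+ j)%:E * wlq_sum delta s r setT G.
  rewrite -[wlq_sum _ _ _ _ _](esum_shift j a0).
  by rewrite esumZl// mulr_ge0 ?powR_ge0 ?exprn_ge0 ?(ltW t0).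
rewrite (eq_eseriesr (fun j _ => E j)).
apply: (@le_trans _ _ ((1 - t)^-1%:E * ((c `^ r)%:E * wlq_sum delta s r setT G))); last first.
  by rewrite muleA -EFinM mulrC.
have S0 := wlq_sum_ge0 r setT G.
apply: nneseries_le_geometric.
- by rewrite t1 ltW.
- by move=> j; rewrite mule_ge0// lee_fin mulr_ge0 ?powR_ge0 ?exprn_ge0 ?(ltW t0).
- by rewrite mule_ge0// lee_fin powR_ge0.
- by move=> j; rewrite muleA -EFinM mulrC.
Qed.

End tail_sup.

(** * [L^p] quasi-norms of series with geometric coefficients *)

Section Lnorm_tail_sup.
Local Open Scope ereal_scope.
Context {d} {T : measurableType d} {R : realType}.
Variable mu : {measure set T -> \bar R}.

(* [F] need not be measurable, but each [m k] must be, for the integral to be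
   countably additive on the majorant of [F]. *)
Lemma Lnorm_tail_sup (p : \bar R) (sigma : R) : 0 < p -> (0 < sigma)%R ->
  exists2 rho : R, (0 < rho)%R & forall c : R, (0 < c)%R ->
  exists2 C : R, (0 < C)%R &
    forall (F : T -> \bar R) (m : int -> T -> \bar R) (k : int),
    (forall x, 0 <= F x) -> (forall i x, 0 <= m i x) ->
    (forall i, measurable_fun setT (m i)) ->
    (forall x, F x <= \sum_(j <oo) (c * rho ^+ j)%:E * m (k - j%:Z)%R x) ->
    Lnorm mu p F <= C%:E * tail_sup sigma (fun i => Lnorm mu p (m i)) k.
Proof.
move=> p0 s0.
have sum_sup (rho c : R) (F : T -> \bar R) (m : int -> T -> \bar R) (k : int) :
    (0 < rho)%R -> (0 < c)%R -> (forall i x, 0 <= m i x) ->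
    (forall x, F x <= \sum_(j <oo) (c * rho ^+ j)%:E * m (k - j%:Z)%R x) ->
    forall x, F x <= (2 * c)%:E * tail_sup (2 * rho) (m^~ x) k.
  move=> rho0 c0 m0 Fm x; apply: le_trans (Fm x) _.
  by apply: (nneseries_le_tail_sup (G := m^~ x)) => //; exact: ltW.
have tail_ge0 (r : R) (m : int -> T -> \bar R) k :
    0 <= tail_sup r (fun i => Lnorm mu p (m i)) k.
  by apply: le_trans (tail_sup_ge _ _ _ 0); rewrite mule_ge0 ?Lnorm_ge0// lee_fin.
case: p p0 tail_ge0 => [p|_|//]; last first.
  move=> tail_ge0; exists (sigma / 2)%R; first by rewrite divr_gt0.
  have rho0 : (0 < sigma / 2)%R by rewrite divr_gt0.
  move=> c c0; exists (2 * c)%R; first by rewrite mulr_gt0.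
  move=> F m k F0 m0 mm Fm.
  have {}Fm := sum_sup _ _ _ _ _ rho0 c0 m0 Fm.
  have e2 : (2 * (sigma / 2))%R = sigma by field.
  rewrite e2 in Fm; have c20 : (0 <= 2 * c)%R by rewrite mulr_ge0// ltW.
  have tg := tail_ge0 sigma m k; move: tg; rewrite unlock.
  case: ifPn => [muT tg|_ tg]; last by rewrite mule_ge0// lee_fin.
  apply/ess_supP.
  (* A countable union of null sets is null, so one exceptional set works for all [j]. *)
  have : \forall x \ae mu, forall j : nat, (abse \o m (k - j%:Z)%R) x <= ess_sup mu (abse \o m (k - j%:Z)%R).
    by apply/ae_foralln => j; exact: ess_sup_ge.
  apply: filterS => x mx /=; rewrite gee0_abs//.
  apply: le_trans (Fm x) _; rewrite lee_wpmul2l ?lee_fin//.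
  apply: ge_ereal_sup => _ [j _ <-].
  apply: le_trans; last by apply: ereal_sup_ubound; exists j.
  rewrite lee_wpmul2l ?lee_fin ?exprn_ge0 ?(ltW s0)//.
  by have /= := mx j; rewrite gee0_abs.
rewrite lte_fin => p0 tail_ge0.
(* In [rho = sigma / (2 b)] the 2 pays for replacing the series by a supremum. Since [b^p = 2],
   taking [p]-th powers leaves a summable factor [2^-j] in front of [sigma^(j p)]. *)
pose b : R := (2 `^ p^-1)%R.
have b0 : (0 < b)%R by exact: powR_gt0.
pose rho := (sigma / (2 * b))%R.
have rho0 : (0 < rho)%R by rewrite divr_gt0// mulr_gt0.
exists rho => // c c0; exists (2 * c * b)%R; first by rewrite !mulr_gt0.
move=> F m k F0 m0 mm Fm.
have {}Fm := sum_sup _ _ _ _ _ rho0 c0 m0 Fm.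
have c20 : (0 <= 2 * c)%R by rewrite mulr_ge0// ltW.
have T0 := tail_ge0 sigma m k.
set S := tail_sup sigma _ k in T0 *.
have ps (j : nat) : (((2 * rho) ^+ j) `^ p = 2^-1 ^+ j * (sigma ^+ j) `^ p)%R.
  have -> : 2^-1%R = (b^-1 `^ p)%R :> R.
    by rewrite /b -powRN -powRrM mulNr mulVf ?gt_eqF// powR_inv1.
  have bi0 : (0 <= b^-1)%R by rewrite invr_ge0 ltW.
  have -> : ((b^-1 `^ p) ^+ j = (b^-1 ^+ j) `^ p)%R.
    by rewrite -!powR_mulrn ?powR_ge0// -!powRrM mulrC.
  rewrite -powRM ?exprn_ge0 ?(ltW s0)//.
  by rewrite -exprMn; congr ((_ ^+ _) `^ _)%R; rewrite /rho; field; rewrite gt_eqF.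
have b2 : (b `^ p = 2)%R by rewrite /b -powRrM mulVf ?gt_eqF// powRr1.
rewrite unlock -[leRHS](poweRK p0); last first.
  by rewrite mule_ge0// lee_fin mulr_ge0// ltW.
apply: lee_poweR; [by rewrite invr_gt0|by apply: integral_ge0 => *; exact: poweR_ge0|].
pose g j x := (((2 * rho) ^+ j) `^ p)%:E * (m (k - j%:Z)%R x `^ p).
have g0 j x : 0 <= g j x by rewrite mule_ge0 ?poweR_ge0// lee_fin powR_ge0.
have mg j : measurable_fun setT (g j).
  apply: measurable_funeM.
  exact: (measurableT_comp (measurable_poweR _)).
apply: (@le_trans _ _ (\int[mu]_x (((2 * c) `^ p)%:E * \sum_(j <oo) g j x))).
  apply: ge0_le_lower_integral => x _; first exact: poweR_ge0.
  rewrite gee0_abs//; apply: (@le_trans _ _ (((2 * c)%:E * tail_sup (2 * rho) (m^~ x) k) `^ p)).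
    exact: lee_poweR.
  have r20 : (0 <= 2 * rho)%R by rewrite mulr_ge0// ltW.
  have t0 : 0 <= tail_sup (2 * rho) (m^~ x) k.
    by apply: le_trans (tail_sup_ge _ _ _ 0); rewrite mule_ge0// lee_fin.
  rewrite poweRM ?lee_fin// poweR_EFin lee_wpmul2l ?lee_fin ?powR_ge0//.
  apply: le_trans (poweR_ereal_sup_le _ _) _ => //.
    by move=> j; rewrite mule_ge0// lee_fin exprn_ge0.
  rewrite le_eqVlt; apply/orP; left; apply/eqP; apply: eq_eseriesr => j _.
  by rewrite poweRM// lee_fin exprn_ge0.
rewrite ge0_integralZl//; last 3 first.
- by apply: ge0_emeasurable_sum => //.
- by move=> x _; apply: nneseries_ge0 => *; exact: g0.
- by rewrite lee_fin powR_ge0.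
rewrite integral_nneseries//.
have -> : ((2 * c * b)%:E * S) `^ p = ((2 * c) `^ p)%:E * (2%:E * S `^ p).
  have cb0 : 0 <= (2 * c * b)%:E by rewrite lee_fin mulr_ge0// ltW.
  by rewrite (poweRM p cb0 T0) poweR_EFin powRM ?(ltW b0)// b2 EFinM -muleA.
rewrite lee_wpmul2l ?lee_fin ?powR_ge0//.
have -> : 2%:E = ((1 - 2^-1)^-1)%:E :> \bar R by congr EFin; field.
apply: nneseries_le_geometric.
- by apply/andP; split; lra.
- by move=> j; apply: integral_ge0 => x _; exact: g0.
- exact: poweR_ge0.
move=> j; rewrite /g ge0_integralZl//; last 3 first.
- exact: (measurableT_comp (measurable_poweR _)).
- by move=> x _; exact: poweR_ge0.
- by rewrite lee_fin powR_ge0.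
rewrite ps EFinM -muleA lee_wpmul2l ?lee_fin ?exprn_ge0//.
have -> : \int[mu]_x (m (k - j%:Z)%R x `^ p) = Lnorm mu p%:E (m (k - j%:Z)%R) `^ p.
  rewrite poweR_Lnorm ?gt_eqF//; apply: eq_integral => x _.
  by rewrite gee0_abs.
rewrite -poweR_EFin -poweRM ?Lnorm_ge0 ?lee_fin ?exprn_ge0 ?(ltW s0)//.
apply: lee_poweR => //; first by rewrite mule_ge0 ?Lnorm_ge0// lee_fin exprn_ge0 ?(ltW s0).
exact: tail_sup_ge.
Qed.

End Lnorm_tail_sup.

(** Bernoulli's inequality: [t ^+ n] is at least [1 + (t - 1) n]. *)
Lemma exists_exprn_gt {R : realType} (t x : R) : 1 < t -> exists n, x < t ^+ n.
Proof.
move=> t1; have t10 : 0 < t - 1 by rewrite subr_gt0.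
have bern n : 1 + (t - 1) * n%:R <= t ^+ n.
  elim: n => [|n IH]; first by rewrite mulr0 addr0 expr0.
  have t0 : 0 <= t by lra.
  apply: (@le_trans _ _ (t * (1 + (t - 1) * n%:R))); last by rewrite exprS ler_wpM2l.
  have n0 : 0 <= (t - 1) * n%:R by rewrite mulr_ge0// ltW.
  by rewrite -natr1; nra.
exists (Num.truncn (x / (t - 1))).+1; apply: lt_le_trans (bern _).
have := truncnS_gt (x / (t - 1)); rewrite ltr_pdivrMr// mulrC; lra.
Qed.

(** * Balls, their volumes, and integration over shells *)

Section geometry.
Context {R : realType} {disp : measure_display} {X : measurableType disp}.
Variables (mu : {measure set X -> \bar R}) (dist : X -> X -> R) (A0 Cmu : R).
Hypothesis hX : homogeneous_space mu dist A0 Cmu.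
Implicit Types (x y : X) (r : R).

Local Notation qball := (qball dist).
Local Notation vol := (vol mu dist).

Let hd : quasi_metric dist A0 := homogeneous_quasi_metric hX.

Lemma A0_gt0 : 0 < A0.
Proof. exact: lt_le_trans (quasi_metric_const_ge1 hd). Qed.

Lemma dist_refl x : dist x x = 0.
Proof. by apply/(quasi_metric_eq0 hd). Qed.

Lemma qball_subset x y r r' : A0 * (dist x y + r) <= r' ->
  qball x r `<=` qball y r'.
Proof.
move=> rr' u /= xu; apply: lt_le_trans rr'.
apply: le_lt_trans (quasi_metric_triangle hd y x u) _.
by rewrite (quasi_metric_sym hd y x) ltr_pM2l ?A0_gt0// ltrD2l.
Qed.

Lemma mu_qball x r : 0 < r -> mu (qball x r) = (vol x r)%:E.
Proof.
move=> r0; have /andP[m0 moo] := homogeneous_mu_ball hX x r0.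
by rewrite /Defs.vol fineK// ge0_fin_numE// ltW.
Qed.

Lemma vol_gt0 x r : 0 < r -> 0 < vol x r.
Proof.
move=> r0; have /andP[m0 moo] := homogeneous_mu_ball hX x r0.
by rewrite -lte_fin -mu_qball.
Qed.

Lemma vol_ge0 x r : 0 <= vol x r.
Proof. exact/fine_ge0/measure_ge0. Qed.

Lemma measurable_qball x r : 0 < r -> measurable (qball x r).
Proof. exact: homogeneous_measurable_ball hX _ _. Qed.

Lemma le_vol x y r r' : 0 < r -> 0 < r' -> qball x r `<=` qball y r' ->
  vol x r <= vol y r'.
Proof.
move=> r0 r'0 sub; rewrite -lee_fin -!mu_qball//.
by apply: le_measure => //; rewrite inE; exact: measurable_qball.
Qed.

Lemma vol_nondecreasing x r r' : 0 < r -> r <= r' -> vol x r <= vol x r'.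
Proof.
move=> r0 rr'; apply: le_vol => //; first exact: lt_le_trans rr'.
by move=> y /= /lt_le_trans; exact.
Qed.

(** Doubling is iterated until [2 ^+ n] exceeds [c]. *)
Lemma vol_scale (c : R) : 0 < c ->
  exists2 L, 1 <= L & forall x r, 0 < r -> vol x (c * r) <= L * vol x r.
Proof.
move=> c0; have [n cn] : exists n, c < 2 ^+ n by apply: exists_exprn_gt; lra.
exists (Cmu ^+ n); first exact/exprn_ege1/(homogeneous_const_ge1 hX).
move=> x r r0; apply: (@le_trans _ _ (vol x (2 ^+ n * r))).
  by apply: vol_nondecreasing; rewrite ?mulr_gt0// ler_pM2r// ltW.
elim: n {cn} => [|n IH]; first by rewrite !expr0 !mul1r.
have p0 : 0 < 2 ^+ n * r by rewrite mulr_gt0// exprn_gt0.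
rewrite exprS -mulrA; apply: (@le_trans _ _ (Cmu * vol x (2 ^+ n * r))).
  rewrite -lee_fin EFinM -!mu_qball// ?mulr_gt0//.
  exact: homogeneous_doubling hX _ _ p0.
rewrite exprS -mulrA ler_wpM2l// (le_trans _ (homogeneous_const_ge1 hX))//.
Qed.

(** The first ball lies in the ball of radius [2 A0 c r] about [y], whose volume is controlled by
    doubling. *)
Lemma vol_near (c : R) : 0 < c ->
  exists2 L, 1 <= L & forall x y r, 0 < r -> dist x y <= c * r ->
    vol x (c * r) <= L * vol y r.
Proof.
move=> c0; have A00 := A0_gt0.
have [|L L1 LP] := @vol_scale (A0 * (2 * c)); first by rewrite !mulr_gt0.
exists L => // x y r r0 xy; apply: le_trans (LP y r r0).
apply: le_vol; rewrite ?mulr_gt0//; apply: qball_subset.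
by rewrite -mulrA ler_pM2l//; lra.
Qed.

(** On the shell of points whose first ball has index [j], the integrand is at most [b j / vol]
    times [h]. Enlarging each shell to its full ball gives a series of measurable functions, which
    can be integrated term by term although [K] need not be measurable. *)
Lemma lower_integral_shells x r (t : R) (K : X -> R) (b : nat -> R)
    (h : X -> \bar R) : 0 < r -> 1 < t ->
  (forall y, 0 <= K y) -> (forall j, 0 <= b j) ->
  (forall j y, qball x (r * t ^+ j) y ->
     (forall i, (i < j)%N -> ~ qball x (r * t ^+ i) y) ->
     K y <= b j / vol x (r * t ^+ j)) ->
  (forall y, 0 <= h y)%E -> measurable_fun setT h ->
  (\int[mu]_y (h y * (K y)%:E) <=
   \sum_(j <oo) (b j)%:E * ((vol x (r * t ^+ j))^-1%:E *
     \int[mu]_(y in qball x (r * t ^+ j)) h y))%E.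
Proof.
move=> r0 t1 K0 b0 Kb h0 mh.
have t0 : 0 < t by lra.
have rt0 j : 0 < r * t ^+ j by rewrite mulr_gt0// exprn_gt0.
pose B j := qball x (r * t ^+ j).
have mB j : measurable (B j) by exact: measurable_qball.
pose w j := b j / vol x (r * t ^+ j).
have w0 j : 0 <= w j by rewrite divr_ge0// vol_ge0.
pose g j y := ((w j)%:E * (h \_ (B j)) y)%E.
have hB0 j y : (0 <= (h \_ (B j)) y)%E by exact: erestrict_ge0.
have g0 j y : (0 <= g j y)%E by rewrite mule_ge0// lee_fin.
have mhB j : measurable_fun setT (h \_ (B j)).
  by apply/(measurable_restrictT _ _).1 => //; exact: measurable_funTS.
apply: (@le_trans _ _ (\int[mu]_y (\sum_(j <oo) g j y)))%E.
  apply: ge0_le_lower_integral => y _; first by rewrite mule_ge0// lee_fin.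
  have ex : exists j, `[< B j y >].
    have [j rj] := exists_exprn_gt (dist x y / r) t1.
    by exists j; apply/asboolP; rewrite /B /Defs.qball/= mulrC -ltr_pdivrMr.
  have [j /asboolP Bj jmin] := ex_minnP ex.
  apply: (@le_trans _ _ (g j y)).
    rewrite /g /patch ifT ?inE// muleC lee_wpmul2r// lee_fin Kb// => i ij Bi.
    by have := jmin i (asboolT Bi); rewrite leqNgt ij.
  rewrite (@nneseries_split _ _ 0 j.+1)// add0n big_nat_recr//= addeAC leeDr// adde_ge0//.
    by apply: sume_ge0 => *; exact: g0.
  by apply: nneseries_ge0 => *; exact: g0.
rewrite integral_nneseries//; last by move=> j; exact: measurable_funeM.
rewrite le_eqVlt; apply/orP; left; apply/eqP; apply: eq_eseriesr => j _.
by rewrite /g ge0_integralZl ?lee_fin// -integral_mkcond EFinM muleA.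
Qed.

End geometry.

(** * Decay of test weights and of exp-ATI kernels along shells *)

Section shells.
Context {R : realType} {disp : measure_display} {X : measurableType disp}.
Variables (mu : {measure set X -> \bar R}) (dist : X -> X -> R) (A0 Cmu : R).
Hypothesis hX : homogeneous_space mu dist A0 Cmu.
Implicit Types (x y : X) (r t : R).

Local Notation qball := (qball dist).
Local Notation vol := (vol mu dist).

Let hd : quasi_metric dist A0 := homogeneous_quasi_metric hX.

(** On the shell of radius about [r0 t^j] the weight is comparable with [t^(-j c)] over the volume
    of the ball. *)
Lemma lower_integral_test_weight (x0 : X) (r0 c t : R) :
  0 < r0 -> 0 < c -> 1 < t ->
  exists2 C : R, 0 < C & forall h : X -> \bar R,
  (forall y, 0 <= h y)%E -> measurable_fun setT h ->
  (\int[mu]_y (h y * (test_weight mu dist x0 r0 c y)%:E) <=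
   \sum_(j <oo) (C * (t^-1 `^ c) ^+ j)%:E * ((vol x0 (r0 * t ^+ j))^-1%:E *
     \int[mu]_(y in qball x0 (r0 * t ^+ j)) h y))%E.
Proof.
move=> r00 c0 t1; have t0 : 0 < t by lra.
have [L L1 LP] := vol_scale hX t0.
have L0 : 0 < L by lra.
have tc1 : 1 <= t `^ c.
  by have := @ler_powR _ t (ltW t1) 0 c (ltW c0); rewrite powRr0.
exists (L * t `^ c); first by rewrite mulr_gt0 ?powR_gt0.
have V0 r : 0 <= vol x0 r by exact: vol_ge0.
have d0 y : 0 <= dist x0 y := quasi_metric_ge0 hd x0 y.
have rt0 j : 0 < r0 * t ^+ j by rewrite mulr_gt0// exprn_gt0.
have frac y : 0 <= r0 / (r0 + dist x0 y) <= 1.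
  have := d0 y => dy; rewrite divr_ge0 ?addr_ge0 ?(ltW r00)//=.
  by rewrite ler_pdivrMr ?mul1r ?lerDl//; lra.
move=> h h0 mh; apply: lower_integral_shells => //.
- exact: hX.
- move=> y; rewrite /test_weight mulr_ge0 ?powR_ge0// invr_ge0 addr_ge0//.
- by move=> j; rewrite !mulr_ge0 ?exprn_ge0 ?powR_ge0 ?(ltW L0).
(* A point of shell [j + 1] is only known to be at distance at least [r0 t^j]. This loss of one
   index costs [L] in the volume and [t^c] in the decay. The central shell uses [V_r(x_0)] and a
   fraction at most 1. *)
move=> [|j] y _ far; rewrite /test_weight.
  rewrite expr0 !mulr1 mulrC.
  have /andP[f0 f1] := frac y.
  apply: ler_pM; rewrite ?powR_ge0 ?invr_ge0 ?addr_ge0//.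
    apply: (@le_trans _ _ 1); last by nra.
    by have := @ge0_ler_powR _ c (ltW c0) _ _ f0 (ler01 : 1 \is Num.nneg) f1; rewrite powR1.
  by rewrite lef_pV2 ?posrE ?ltr_wpDr ?vol_gt0 // ?(vol_gt0 hX)// lerDl.
have dj : r0 * t ^+ j <= dist x0 y by rewrite leNgt; apply/negP; exact: far.
have tj0 : 0 < t ^+ j by rewrite exprn_gt0.
have f1 : r0 / (r0 + dist x0 y) <= t^-1 ^+ j.
  by rewrite exprVn ler_pdivrMr ?ltr_wpDr// mulrC ler_pdivlMr//; have := d0 y; lra.
rewrite mulrC; apply: (@le_trans _ _ ((t^-1 `^ c) ^+ j * (L / vol x0 (r0 * t ^+ j.+1)))).
  apply: ler_pM; rewrite ?powR_ge0 ?invr_ge0 ?addr_ge0//.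
    have -> : (t^-1 `^ c) ^+ j = (t^-1 ^+ j) `^ c.
      have ti0 : 0 <= t^-1 by rewrite invr_ge0 ltW.
      by rewrite -!powR_mulrn ?powR_ge0// -!powRrM mulrC.
    have /andP[fr0 _] := frac y.
    apply: ge0_ler_powR; rewrite ?nnegrE ?(ltW c0)//.
    by rewrite exprn_ge0// invr_ge0 ltW.
  rewrite -invf_div lef_pV2 ?posrE ?divr_gt0 ?ltr_wpDr ?(vol_gt0 hX)//.
  rewrite ler_pdivrMr// mulrDl.
  have VL : vol x0 (r0 * t ^+ j.+1) <= L * vol x0 (dist x0 y).
    rewrite exprS mulrCA; apply: le_trans (LP _ _ (rt0 j)) _.
    by rewrite ler_pM2l// (vol_nondecreasing hX).
  by have := mulr_ge0 (V0 r0) (ltW L0); lra.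
set V := vol _ _; set w := t^-1 `^ c.
have wE : t `^ c * w = 1.
  by rewrite /w -powRM ?invr_ge0 ?(ltW t0)// divff ?gt_eqF// powR1.
rewrite exprS -[leLHS]mul1r -wE le_eqVlt; apply/orP; left; apply/eqP; ring.
Qed.

(** [e^u] is the power [n + 1] of [e^(u/(n+1))], which is at least [u/(n+1)]. *)
Lemma expR_oppr_le (u : R) (n : nat) : 0 < u ->
  expR (- u) <= (n.+1%:R / u) ^+ n.+1.
Proof.
move=> u0; rewrite expRN -[n.+1%:R / u]invf_div exprVn.
have un : 0 < u / n.+1%:R by rewrite divr_gt0.
rewrite lef_pV2 ?posrE ?expR_gt0 ?exprn_gt0//.
have e : u = n.+1%:R * (u / n.+1%:R) by rewrite mulrCA divff ?mulr1.
rewrite [in leRHS]e expRM_natl lerXn2r ?nnegrE ?expR_ge0 ?(ltW un)//.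
by apply: le_trans (expR_ge1Dx _); rewrite lerDr.
Qed.

(** The exponential beats every power of [u^a], so along a geometric sequence it beats every
    geometric rate: [n] is taken with [(t^a)^n > 1/sigma]. *)
Lemma expR_powR_decay (nu a b t sigma : R) :
  0 < nu -> 0 < a -> 0 < b -> 1 < t -> 0 < sigma ->
  exists2 E, 0 < E & forall (i : nat) (u : R), b * t ^+ i <= u ->
    expR (- (nu * u `^ a)) <= E * sigma ^+ i.
Proof.
move=> nu0 a0 b0 t1 s0; have t0 : 0 < t by lra.
have ta1 : 1 < t `^ a.
  by have := @gt0_ltr_powR _ a a0 1 t; rewrite powR1; apply; rewrite ?nnegrE// ltW.
have ta0 : 0 < t `^ a by lra.
have [n sn] := exists_exprn_gt sigma^-1 ta1.
have w0 : 0 < nu * b `^ a by rewrite mulr_gt0 ?powR_gt0.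
exists ((n.+1%:R / (nu * b `^ a)) ^+ n.+1); first by rewrite exprn_gt0// divr_gt0.
move=> i u ui; have bt0 : 0 < b * t ^+ i by rewrite mulr_gt0// exprn_gt0.
have e : (b * t ^+ i) `^ a = b `^ a * (t `^ a) ^+ i.
  rewrite powRM ?exprn_ge0 ?(ltW b0) ?(ltW t0)//; congr (_ * _).
  by rewrite -!powR_mulrn ?powR_ge0 ?(ltW t0)// -!powRrM mulrC.
apply: (@le_trans _ _ (expR (- (nu * (b * t ^+ i) `^ a)))).
  rewrite ler_expR lerN2 ler_pM2l//.
  by apply: ge0_ler_powR; rewrite ?nnegrE ?(ltW a0) ?(ltW bt0)// (le_trans (ltW bt0)).
apply: le_trans (expR_oppr_le n _) _; first by rewrite mulr_gt0 ?powR_gt0.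
rewrite e mulrA invfM mulrA exprMn ler_pM2l; last by rewrite exprn_gt0// divr_gt0.
rewrite -exprVn -exprM mulnC exprM lerXn2r ?nnegrE ?exprn_ge0 ?invr_ge0 ?(ltW ta0) ?(ltW s0)//.
rewrite exprVn invf_ple ?posrE ?exprn_gt0//; apply: le_trans (ltW sn) _.
by rewrite ler_weXn2l// ltW.
Qed.

(** The centre is moved once, at the largest radius; then [j] scalings by [t] bring the radius down.
    This growth in [j] is geometric, so the exponential decay can absorb it. *)
Lemma vol_shell (b t : R) : 0 < b -> 1 < t ->
  exists2 L, 1 <= L & forall x y r (j : nat), 0 < r ->
    dist x y <= b * r * t ^+ j ->
    vol x (b * r * t ^+ j) <= L ^+ j.+1 * vol y r.
Proof.
move=> b0 t1; have t0 : 0 < t by lra.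
have [L1 L11 L1P] := vol_near hX b0.
have [L2 L21 L2P] := vol_scale hX t0.
exists (L1 * L2); first by nra.
move=> x y r j r0; rewrite -mulrA => xy.
have rt0 : 0 < r * t ^+ j by rewrite mulr_gt0// exprn_gt0.
apply: le_trans (L1P _ _ _ rt0 xy) _.
rewrite exprMn -mulrA; apply: ler_pM => //; [lra|exact: vol_ge0| |].
  by rewrite exprS ler_peMr ?exprn_ege1//; lra.
apply: (@le_trans _ _ (L2 ^+ j * vol y r)); last first.
  by rewrite ler_wpM2r ?vol_ge0// exprS ler_peMl// exprn_ge0//; lra.
elim: j {rt0 xy} => [|j IH]; first by rewrite !expr0 mulr1 mul1r.
have rt0 : 0 < r * t ^+ j by rewrite mulr_gt0// exprn_gt0.
rewrite exprS mulrCA; apply: le_trans (L2P _ _ rt0) _.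
by rewrite exprS -mulrA ler_wpM2l//; lra.
Qed.

Context {I : Type}.
Variables (delta : R) (A : int -> set I) (z : int -> I -> X).
Hypotheses (delta_gt0 : 0 < delta) (delta_lt1 : delta < 1).

(** The factor containing the distance to the new points is at most 1, and equals 0 when that
    distance is infinite. *)
Lemma exp_bound_le nu a k x y : 0 < nu ->
  exp_bound mu dist delta A z nu a k x y <=
  (Num.sqrt (vol x (delta ^ k) * vol y (delta ^ k)))^-1
  * expR (- (nu * (dist x y / delta ^ k) `^ a)).
Proof.
move=> nu0; rewrite /exp_bound ler_piMr ?mulr_ge0 ?expR_ge0 ?invr_ge0//.
set u := (nu%:E * _)%E.
have u0 : (0 <= u)%E by rewrite mule_ge0 ?poweR_ge0// lee_fin ltW.
case: u u0 => [u| |]//=; rewrite ?lee_fin => u0.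
by rewrite -expR0 ler_expR oppr_le0.
Qed.

Lemma lower_integral_kernel (Q : int -> X -> X -> R) (Ct C nu a rho : R) :
  0 < Ct -> 0 < C -> 0 < nu -> 0 < a -> 0 < rho ->
  (forall k x y, `|Q k x y| <= C * exp_bound mu dist delta A z nu a k x y) ->
  exists2 C' : R, 0 < C' & forall k x (h : X -> \bar R),
  (forall y, 0 <= h y)%E -> measurable_fun setT h ->
  (\int[mu]_y (h y * `|Q k x y|%:E) <=
   \sum_(j <oo) (C' * rho ^+ j)%:E * ((vol x (Ct * delta ^ (k - j%:Z)))^-1%:E *
     \int[mu]_(y in qball x (Ct * delta ^ (k - j%:Z))) h y))%E.
Proof.
move=> Ct0 C0 nu0 a0 rho0 QC.
have t1 : 1 < delta^-1 by rewrite invf_gt1.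
have t0 : 0 < delta^-1 by rewrite invr_gt0.
have [L L1 LP] := vol_shell Ct0 t1.
have L0 : 0 < L by lra.
(* Volumes grow by at most [L] per shell, so decay of the exponential at rate [rho / L] leaves the
   rate [rho]. *)
pose sigma := rho / L.
have s0 : 0 < sigma by rewrite divr_gt0.
have [E E0 EP] := expR_powR_decay nu0 a0 Ct0 t1 s0.
(* The summand 1 serves the central shell. On shell [j + 1] the distance bound has index [j], which
   costs a factor [1 / sigma]. *)
pose E' := 1 + E / sigma.
have E'0 : 0 < E' by rewrite addr_gt0// divr_gt0.
exists (C * (L * E')); first by rewrite !mulr_gt0.
move=> k x h h0 mh.
have dk0 : 0 < delta ^ k by rewrite exprz_gt0.
have e j : Ct * delta ^ (k - j%:Z) = Ct * delta ^ k * delta^-1 ^+ j.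
  by rewrite -mulrA expfzDr ?gt_eqF// -exprnN exprVn.
under eq_eseriesr do rewrite e.
apply: lower_integral_shells => //.
- exact: hX.
- by rewrite mulr_gt0.
- by move=> j; rewrite !mulr_ge0 ?exprn_ge0 ?(ltW C0) ?(ltW L0) ?(ltW E'0) ?(ltW rho0).
have e2 (j : nat) y :
    (forall i, (i < j)%N -> ~ qball x (Ct * delta ^ k * delta^-1 ^+ i) y) ->
    expR (- (nu * (dist x y / delta ^ k) `^ a)) <= E' * sigma ^+ j.
  case: j => [_|j far].
    apply: (@le_trans _ _ 1); last by rewrite expr0 mulr1 lerDl divr_ge0// ltW.
    by rewrite -expR0 ler_expR oppr_le0 mulr_ge0 ?powR_ge0// ltW.
  apply: le_trans (EP j _ _) _.
    rewrite ler_pdivlMr// mulrAC leNgt; apply/negP; exact: far.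
  rewrite exprS mulrA ler_wpM2r ?exprn_ge0 ?(ltW s0)// mulrDl mul1r divfK ?gt_eqF//.
  by rewrite lerDr ltW.
move=> j y yj far; apply: le_trans (QC _ _ _) _.
have r0 : 0 < Ct * delta ^ k * delta^-1 ^+ j by rewrite !mulr_gt0// exprn_gt0.
have Vj0 := vol_gt0 hX x r0.
set V := vol x (_ * _) in Vj0 *.
rewrite -!mulrA ler_pM2l//; apply: le_trans (exp_bound_le _ _ _ _ nu0) _.
have Vy : V / L ^+ j.+1 <= vol y (delta ^ k).
  by rewrite ler_pdivrMr ?exprn_gt0// mulrC LP// ltW.
have Vx : V / L ^+ j.+1 <= vol x (delta ^ k).
  by rewrite ler_pdivrMr ?exprn_gt0// mulrC LP// (dist_refl hX) ltW.
have VL0 : 0 < V / L ^+ j.+1 by rewrite divr_gt0// exprn_gt0.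
(* Both volumes at scale [delta ^ k] are at least [V / L ^+ j.+1], hence so is their geometric
   mean. *)
have e1 : (Num.sqrt (vol x (delta ^ k) * vol y (delta ^ k)))^-1 <= L ^+ j.+1 / V.
  rewrite -[leRHS]invf_div lef_pV2 ?posrE ?VL0 ?sqrtr_gt0 ?mulr_gt0 ?(vol_gt0 hX)//.
  rewrite -[leLHS](ger0_norm (ltW VL0)) -sqrtr_sqr ler_wsqrtr// expr2.
  by apply: ler_pM => //; exact: ltW.
apply: le_trans (ler_pM _ _ e1 (e2 _ _ far)) _; rewrite ?invr_ge0 ?expR_ge0//.
rewrite le_eqVlt; apply/orP; left; apply/eqP.
rewrite /sigma expr_div_n exprS; field.
by rewrite !gt_eqF// exprn_gt0.
Qed.

End shells.

(** * Pairing with functions of mean zero *)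

Section pairing.
Context {R : realType} {disp : measure_display} {X : measurableType disp}.
Variable mu : {measure set X -> \bar R}.

(** By the identity [f g = c g - (c - f) g], where [c g] is integrable with integral zero. The
    constant [c] will be [f x] for kernels and a fixed value of [f] for test functions. *)
Lemma mean_zero_pairing (f g : X -> R) (c : R) :
  measurable_fun setT f -> mu.-integrable setT (EFin \o g) ->
  (\int[mu]_x (g x)%:E = 0)%E ->
  (\int[mu]_y (`|c - f y|%:E * `|g y|%:E) < +oo)%E ->
  mu.-integrable setT (fun x => (f x * g x)%:E) /\
  (`|\int[mu]_x (f x * g x)|%:E <= \int[mu]_y (`|c - f y|%:E * `|g y|%:E))%E.
Proof.
move=> mf ig g0 fin.
have mg : measurable_fun setT g by case/integrableP: ig => /measurable_EFinP.
have absE : (fun y => `|c - f y|%:E * `|g y|%:E)%E = (fun y => `|((c - f y) * g y)%:E|%E).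
  by apply/funext => y; rewrite -EFinM -normrM.
have id : mu.-integrable setT (fun y => ((c - f y) * g y)%:E).
  apply/integrableP; split; last by rewrite -absE.
  by apply/measurable_EFinP; apply: measurable_funM => //; exact: measurable_funB.
have icg : mu.-integrable setT (fun y => (c * g y)%:E).
  under eq_fun do rewrite EFinM; exact: integrableZl.
have fgE : (fun y => f y * g y) = (fun y => c * g y - (c - f y) * g y).
  by apply/funext => y; ring.
have ifg : mu.-integrable setT (fun y => (f y * g y)%:E).
  have -> : (fun y => (f y * g y)%:E) = (fun y => ((c * g y)%:E - ((c - f y) * g y)%:E)%E).
    by apply/funext => y; rewrite -EFinB; congr EFin; ring.
  exact: integrableB.
split => //; rewrite fgE RintegralB// RintegralZl//.
rewrite [X in c * X]/Rintegral g0 mulr0 sub0r normrN absE.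
by rewrite EFin_normr_Rintegral//; apply: le_abse_integral => //; case/integrableP: id.
Qed.

End pairing.

(** * Bounds by oscillations, and functions of controlled oscillation as distributions *)

Section distribution.
Context {R : realType} {disp : measure_display} {X : measurableType disp}.
Variables (mu : {measure set X -> \bar R}) (dist : X -> X -> R) (A0 Cmu : R).
Hypothesis hX : homogeneous_space mu dist A0 Cmu.
Variables (delta Ct : R).
Hypotheses (delta_gt0 : 0 < delta) (delta_lt1 : delta < 1) (Ct_gt0 : 0 < Ct).

Local Notation qball := (qball dist).
Local Notation vol := (vol mu dist).
Local Notation oscillation := (oscillation mu dist delta Ct).

Let hd : quasi_metric dist A0 := homogeneous_quasi_metric hX.

Lemma oscillation_ge0 (f : X -> R) x k : (0 <= oscillation f x k)%E.
Proof.
by rewrite mule_ge0 ?lee_fin ?invr_ge0 ?fine_ge0//; exact: integral_ge0.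
Qed.

Lemma pairing_le_oscillation (I : Type) (A : int -> set I) (z : int -> I -> X)
    (eta rho : R) (Q : int -> X -> X -> R) :
  exp_ATI mu dist delta A z eta Q -> 0 < rho ->
  exists2 C : R, 0 < C & forall (f : X -> R) k x, measurable_fun setT f ->
  (`|\int[mu]_y (f y * Q k x y)|%:E <=
   \sum_(j <oo) (C * rho ^+ j)%:E * oscillation f x (k - j%:Z))%E.
Proof.
move=> hQ rho0.
have [CQ [nu [a [CQ0 nu0 a0 _ hE]]]] := exp_ATI_bounds hQ.
have QC := exp_ATI_size hE.
have kernel rho' (rho'0 : 0 < rho') := lower_integral_kernel hX delta_gt0 delta_lt1 Ct_gt0 CQ0 nu0 a0 rho'0 QC.
(* The rate [1/2] with [h = 1], all of whose means are 1, will give the integrability of [Q k x]. *)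
have h0 : (0 : R) < 2^-1 by lra.
have [C1 C10 C1P] := kernel _ h0.
have [C C0 CP] := kernel _ rho0.
exists C => // f k x mf.
have mQ : measurable_fun setT (Q k x).
  have [mK _] := exp_ATI_bounded hQ k.
  exact: (measurableT_comp mK (pair1_measurable x)).
have iQ : mu.-integrable setT (EFin \o Q k x).
  apply/integrableP; split; first exact/measurable_EFinP.
  have := C1P k x (cst 1%E) (fun=> lee01) (measurable_cst _).
  under eq_integral do rewrite mul1e.
  move=> /le_lt_trans; apply.
  apply: (@le_lt_trans _ _ ((1 - 2^-1)^-1%:E * C1%:E)%E); last by rewrite -EFinM ltry.
  apply: nneseries_le_geometric; [by apply/andP; split; lra| |by rewrite lee_fin ltW|].
    move=> j; rewrite mule_ge0//; first by rewrite lee_fin mulr_ge0 ?exprn_ge0 ?(ltW C10) ?(ltW h0).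
    by rewrite mule_ge0 ?lee_fin ?invr_ge0 ?vol_ge0//; exact: integral_ge0.
  move=> j; have r0 : 0 < Ct * delta ^ (k - j%:Z) by rewrite mulr_gt0// exprz_gt0.
  rewrite integral_cst; last exact: (measurable_qball hX).
  rewrite mul1e (mu_qball hX)// -!EFinM mulVf ?mulr1 ?gt_eqF ?(vol_gt0 hX)//.
  by rewrite mulrC.
have Bd := CP k x (fun y => `|f x - f y|%:E) (fun y => abse_ge0 (f x - f y)%:E).
have mB : measurable_fun setT (fun y => `|f x - f y|%:E).
  apply/measurable_EFinP; apply: measurableT_comp => //; exact: measurable_funB.
have {}Bd := Bd mB.
have [fin|] := ltP (\int[mu]_y (`|f x - f y|%:E * `|Q k x y|%:E))%E +oo%E.
  have [_ ] := mean_zero_pairing mf iQ (exp_ATI_cancel_r hQ k x) fin.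
  by move=> /le_trans; apply.
(* An infinite integral forces the dominating series to be infinite. *)
move=> inf; apply: le_trans Bd; apply: le_trans inf; exact: leey.
Qed.

Variables (x0 : X) (r0 s c : R).
Hypotheses (r0_gt0 : 0 < r0) (s_gt0 : 0 < s) (s_lt : s < c).

(* [p < 1] is allowed in the application, so the averages of [f] on the balls
   [B_j] are compared with values [f (x_j)] at well-chosen points. *)
Lemma lower_integral_oscillation (f : X -> R) (K : R) : measurable_fun setT f -> 0 < K ->
  (forall (k : int) B, measurable B -> qball x0 r0 `<=` B ->
     exists2 x, B x & (oscillation f x k <= (K * delta `^ (k%:~R * s))%:E)%E) ->
  exists c0 W : R, 0 < W /\
    (\int[mu]_y (`|c0 - f y|%:E * (test_weight mu dist x0 r0 c y)%:E) <= W%:E)%E.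
Proof.
move=> mf K0 H.
have A00 := A0_gt0 hX; have A01 := quasi_metric_const_ge1 hd.
pose t := delta^-1.
have t1 : 1 < t by rewrite invf_gt1.
have t0 : 0 < t by lra.
have c_gt0 : 0 < c := lt_trans s_gt0 s_lt.
pose T := t `^ s.
have T1 : 1 < T.
  by have := @gt0_ltr_powR _ s s_gt0 1 t; rewrite powR1; apply; rewrite ?nnegrE ?(ltW t0).
have T0 : 0 < T by lra.
(* [N] is the gap in scale that makes the oscillation ball about any point of [B j], of radius
   [Ct t^(j+N) = b r_j >= 2 A0 r_j], contain [B j]. *)
have [N NP] := exists_exprn_gt (2 * A0 * r0 / Ct) t1.
have {}NP : 2 * A0 * r0 <= Ct * t ^+ N.
  by rewrite [leRHS]mulrC -ler_pdivrMr// ltW.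
pose b := Ct * t ^+ N / r0.
have b2 : 2 * A0 <= b by rewrite ler_pdivlMr.
have b0 : 0 < b by lra.
have [L3 L31 L3P] := vol_near hX b0.
have [L L1 LP] := vol_scale hX t0.
have [Cw Cw0 CwP] := lower_integral_test_weight hX x0 r0_gt0 c_gt0 t1.
pose r j := r0 * t ^+ j.
have rj0 j : 0 < r j by rewrite mulr_gt0// exprn_gt0.
pose B j := qball x0 (r j).
have mB j : measurable (B j) by exact: (measurable_qball hX).
pose V j := vol x0 (r j).
have V0 j : 0 < V j by exact: (vol_gt0 hX).
have muB j : mu (B j) = (V j)%:E by exact: (mu_qball hX).
have BS i j : (i <= j)%N -> B i `<=` B j.
  move=> ij y /lt_le_trans; apply; rewrite ler_pM2l//.
  by rewrite ler_weXn2l// ltW.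
pose kk j : int := - (j + N)%:Z.
have dk j : Ct * delta ^ kk j = b * r j.
  rewrite /kk -exprnN -exprVn -/t /b /r exprD; field; exact: lt0r_neq0.
have ex j : exists x, B j x /\ (oscillation f x (kk j) <= (K * T ^+ (j + N))%:E)%E.
  have [|x Bx Hx] := H (kk j) (B j) (mB j).
    by have := BS 0%N j (leq0n j); rewrite /B /r expr0 mulr1.
  exists x; split => //; move: Hx; congr (_ <= (K * _)%:E)%E.
  rewrite /kk /T /t -powR_mulrn ?powR_ge0// -powRrM.
  rewrite -powR_inv1 ?(ltW delta_gt0)// -powRrM rmorphN/= -pmulrn.
  by congr (_ `^ _); rewrite mulNr mulN1r mulrC.
have [xx xxP] := choice ex.
have mdiff (e : R) D : measurable_fun D (fun y => `|e - f y|%:E).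
  apply/measurable_EFinP; apply: measurableT_comp => //.
  by apply: measurable_funB => //; exact: measurable_funTS.
pose J (e : R) (j : nat) := (\int[mu]_(y in B j) `|e - f y|%:E)%E.
have J0 e j : (0 <= J e j)%E by apply: integral_ge0.
pose K1 := L3 * K * T ^+ N.
have K10 : 0 < K1 by rewrite !mulr_gt0 ?exprn_gt0//; lra.
have JK1 j : (J (f (xx j)) j <= (K1 * T ^+ j * V j)%:E)%E.
  have [Bx ox] := xxP j; set x := xx j in Bx ox *.
  have br0 : 0 < b * r j by rewrite mulr_gt0.
  apply: (@le_trans _ _ (\int[mu]_(y in qball x (b * r j)) `|f x - f y|%:E)%E).
    apply: ge0_subset_integral => //; first exact: (measurable_qball hX).
    apply: (qball_subset hX).
    have dx : dist x0 x < r j by [].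
    apply: (@le_trans _ _ (A0 * (r j + r j))); first by rewrite ler_pM2l// lerD2r ltW.
    by have := ler_wpM2r (ltW (rj0 j)) b2; lra.
  move: ox; rewrite /Defs.oscillation dk -/(vol x (b * r j)).
  rewrite lee_pdivrMl ?(vol_gt0 hX)// => /le_trans; apply.
  rewrite -EFinM lee_fin /K1 exprD.
  have vx : vol x (b * r j) <= L3 * V j.
    apply: L3P => //; rewrite (quasi_metric_sym hd).
    have dx : dist x0 x < r j by [].
    have b1 : 1 <= b by lra.
    by have := ler_wpM2r (ltW (rj0 j)) b1; lra.
  have T0' := ltW T0.
  have KT0 : 0 <= K * (T ^+ j * T ^+ N) by rewrite !mulr_ge0 ?exprn_ge0 ?(ltW K0).
  have := ler_wpM2r KT0 vx; lra.
have VL j : V j.+1 <= L * V j.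
  by rewrite /V /r exprS mulrCA LP ?(rj0 j).
pose K2 := K1 * (1 + L * T).
(* The triangle inequality through [f y] is averaged over [y] in [B j], which lies in [B j.+1]; [L]
   bounds the ratio of their volumes. *)
have stepK j : `|f (xx j.+1) - f (xx j)| <= K2 * T ^+ j.
  rewrite -(ler_pM2r (V0 j)) -lee_fin EFinM -muB -integral_cst//.
  apply: (@le_trans _ _ (J (f (xx j.+1)) j + J (f (xx j)) j)%E).
    rewrite /J -ge0_integralD//; apply: ge0_le_integral => //.
    - by move=> y _; rewrite lee_fin.
    - by apply: emeasurable_funD; exact: mdiff.
    - move=> y _; rewrite -EFinD lee_fin.
      have -> : f (xx j.+1) - f (xx j) = (f (xx j.+1) - f y) - (f (xx j) - f y) by ring.
      exact: ler_normB.
  apply: (@le_trans _ _ ((K1 * T ^+ j.+1 * V j.+1)%:E + (K1 * T ^+ j * V j)%:E)%E).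
    apply: leeD => //; apply: le_trans (JK1 j.+1).
    by apply: ge0_subset_integral => //; exact: BS.
  rewrite -EFinD lee_fin /K2 exprS.
  have T0' := ltW T0.
  have P0 : 0 <= K1 * (T * T ^+ j) by rewrite (mulr_ge0 (ltW K10))// mulr_ge0// exprn_ge0.
  by have := ler_wpM2l P0 (VL j); lra.
have K20 : 0 < K2 by rewrite (mulr_gt0 K10)// addr_gt0// mulr_gt0//; lra.
pose K3 := K2 / (T - 1).
have K30 : 0 < K3 by rewrite divr_gt0// subr_gt0.
(* The increments telescope to a geometric sum of ratio [T > 1], dominated by its last term. *)
have farK j : `|f (xx 0%N) - f (xx j)| <= K3 * T ^+ j.
  elim: j => [|j IH]; first by rewrite subrr normr0 expr0 mulr1 ltW.
  have -> : f (xx 0%N) - f (xx j.+1) = (f (xx 0%N) - f (xx j)) - (f (xx j.+1) - f (xx j)) by ring.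
  apply: le_trans (ler_normB _ _) _; apply: le_trans (lerD IH (stepK j)) _.
  rewrite le_eqVlt; apply/orP; left; apply/eqP; rewrite exprS /K3; field.
  by rewrite gt_eqF// subr_gt0.
exists (f (xx 0%N)).
(* The ratio is [t^(s - c)]: growth of the means against decay of the weight. Here [s < c] is
   used. *)
have rT : 0 <= t^-1 `^ c * T < 1.
  rewrite mulr_ge0 ?powR_ge0 ?(ltW T0)//= /T -powR_inv1 ?(ltW t0)// -powRrM.
  rewrite -powRD; last by rewrite (gt_eqF t0) implybT.
  have -> : -1 * c + s = - (c - s) by ring.
  rewrite powRN invf_lt1 ?powR_gt0//.
  have := @gt0_ltr_powR _ (c - s) _ 1 t; rewrite powR1; apply; rewrite ?nnegrE ?subr_gt0//.
  exact: ltW.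
pose q := t^-1 `^ c * T.
exists ((1 - q)^-1 * (Cw * (K1 + K3))); split.
  rewrite mulr_gt0 ?invr_gt0 ?subr_gt0//; first by case/andP: rT.
  by rewrite mulr_gt0// addr_gt0.
apply: le_trans (CwP _ _ (mdiff _ _)) _ => //.
rewrite EFinM; apply: nneseries_le_geometric => //.
- move=> j; rewrite mule_ge0//; first by rewrite lee_fin mulr_ge0 ?exprn_ge0 ?powR_ge0 ?(ltW Cw0).
  by rewrite mule_ge0// ?lee_fin ?invr_ge0 ?(ltW (V0 _))//; exact: integral_ge0.
- by rewrite lee_fin ltW// mulr_gt0// addr_gt0.
move=> j; have Jb : (J (f (xx 0%N)) j <= ((K1 + K3) * T ^+ j * V j)%:E)%E.
  apply: (@le_trans _ _ (\int[mu]_(y in B j) (`|f (xx 0%N) - f (xx j)|%:E + `|f (xx j) - f y|%:E))%E).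
    apply: ge0_le_integral => //.
    - by apply: emeasurable_funD => //; exact: mdiff.
    - move=> y _; rewrite -EFinD lee_fin.
      have {1}-> : f (xx 0%N) - f y = (f (xx 0%N) - f (xx j)) + (f (xx j) - f y) by ring.
      exact: ler_normD.
  rewrite ge0_integralD// integral_cst// muB.
  apply: (@le_trans _ _ ((K3 * T ^+ j * V j)%:E + (K1 * T ^+ j * V j)%:E)%E).
    by apply: leeD; [rewrite -EFinM lee_fin ler_pM2r|exact: JK1].
  by rewrite -EFinD lee_fin; lra.
apply: (@le_trans _ _ ((Cw * (t^-1 `^ c) ^+ j)%:E * ((V j)^-1%:E * ((K1 + K3) * T ^+ j * V j)%:E))%E).
  rewrite lee_wpmul2l ?lee_fin ?mulr_ge0 ?exprn_ge0 ?powR_ge0 ?(ltW Cw0)//.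
  by rewrite lee_wpmul2l ?lee_fin ?invr_ge0 ?(ltW (V0 _)).
rewrite -!EFinM lee_fin le_eqVlt; apply/orP; left; apply/eqP.
rewrite exprMn; field; exact: lt0r_neq0.
Qed.

(** A test function is bounded by its constant times the weight, which is itself integrable; having
    mean zero, it can be paired with [f - c0] instead of [f]. Taking the infimum over its constants
    gives continuity. *)
Lemma distribution_of_lower_integral (f : X -> R) (eta b c0 W : R) :
  measurable_fun setT f -> 0 < W ->
  (\int[mu]_y (`|c0 - f y|%:E * (test_weight mu dist x0 r0 c y)%:E) <= W%:E)%E ->
  (forall g, test_closure mu dist A0 x0 r0 eta b c g ->
     mu.-integrable setT (fun x => (f x * g x)%:E)) /\
  distribution_space mu dist A0 x0 r0 eta b c (fun g => \int[mu]_x (f x * g x)).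
Proof.
move=> mf W0 hW.
have c_gt0 : 0 < c := lt_trans s_gt0 s_lt.
have t1 : 1 < delta^-1 by rewrite invf_gt1.
have t0 : 0 < delta^-1 by rewrite invr_gt0.
have w0 y : 0 <= test_weight mu dist x0 r0 c y.
  by rewrite mulr_ge0 ?powR_ge0// invr_ge0 addr_ge0 ?vol_ge0.
have wfin : (\int[mu]_y (test_weight mu dist x0 r0 c y)%:E < +oo)%E.
  have [Cw Cw0 CwP] := lower_integral_test_weight hX x0 r0_gt0 c_gt0 t1.
  have := CwP (cst 1%E) (fun=> lee01) (measurable_cst _).
  under eq_integral do rewrite mul1e.
  move=> /le_lt_trans; apply.
  pose q := delta^-1^-1 `^ c.
  have q01 : 0 <= q < 1.
    rewrite powR_ge0/= /q invrK.
    have := @gt0_ltr_powR _ c c_gt0 delta 1; rewrite powR1; apply => //; rewrite ?nnegrE//.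
    exact: ltW.
  apply: (@le_lt_trans _ _ ((1 - q)^-1%:E * Cw%:E)%E); last by rewrite -EFinM ltry.
  apply: nneseries_le_geometric => //; last 2 first.
  - by rewrite lee_fin ltW.
  - move=> j; have rj0 : 0 < r0 * delta^-1 ^+ j by rewrite mulr_gt0// exprn_gt0.
    rewrite integral_cst; last exact: (measurable_qball hX).
    rewrite mul1e (mu_qball hX)// -!EFinM mulVf ?mulr1 ?gt_eqF ?(vol_gt0 hX)//.
    by rewrite mulrC.
  move=> j; rewrite mule_ge0//; first by rewrite lee_fin mulr_ge0 ?exprn_ge0 ?powR_ge0 ?(ltW Cw0).
  by rewrite mule_ge0// ?lee_fin ?invr_ge0 ?vol_ge0//; exact: integral_ge0.
have key g C : measurable_fun setT g -> (\int[mu]_x (g x)%:E = 0)%E ->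
    test_constant mu dist A0 x0 r0 b c g C ->
    mu.-integrable setT (fun x => (f x * g x)%:E) /\
    (`|\int[mu]_x (f x * g x)|%:E <= (W * C)%:E)%E.
  move=> mg g0 [C0 gC _].
  have ig : mu.-integrable setT (EFin \o g).
    apply/integrableP; split; first exact/measurable_EFinP.
    apply: (@le_lt_trans _ _ (C%:E * \int[mu]_y (test_weight mu dist x0 r0 c y)%:E)%E).
      apply: le_trans (lower_integralZl_le _ C0 _); last by move=> y; rewrite lee_fin.
      by apply: ge0_le_lower_integral => y _; rewrite -?EFinM lee_fin.
    apply: lte_mul_pinfty => //; first by rewrite lee_fin ltW.
  have Hb : (\int[mu]_y (`|c0 - f y|%:E * `|g y|%:E) <= (W * C)%:E)%E.
    apply: (@le_trans _ _ (C%:E * \int[mu]_y (`|c0 - f y|%:E * (test_weight mu dist x0 r0 c y)%:E))%E).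
      apply: le_trans (lower_integralZl_le _ C0 _); last by move=> y; rewrite mule_ge0// lee_fin.
      apply: ge0_le_lower_integral => y _; first by rewrite mule_ge0// lee_fin.
      by rewrite muleCA lee_wpmul2l ?lee_fin// -EFinM lee_fin.
    by rewrite mulrC EFinM lee_wpmul2l// lee_fin ltW.
  have [if1 if2] := mean_zero_pairing mf ig g0 (le_lt_trans Hb (ltry _)).
  by split => //; exact: le_trans if2 Hb.
have intf g : test_closure mu dist A0 x0 r0 eta b c g ->
    mu.-integrable setT (fun x => (f x * g x)%:E).
  by move=> [[[mg [C gC]] g0] _]; have [] := key g C mg g0 gC.
split => //; split.
  move=> u g h cg ch; have ig := intf _ cg; have ih := intf _ ch.
  rewrite -RintegralZl// -RintegralD//; last first.
    by rewrite /comp; under eq_fun do rewrite EFinM; exact: integrableZl.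
  by apply: eq_Rintegral => x _; ring.
exists W => g [[[mg [C gC]] g0] _].
rewrite -lee_pdivrMl//; apply: le_ereal_inf_tmp => _ [C' gC' <-].
by rewrite lee_pdivrMl// -EFinM; have [] := key g C' mg g0 gC'.
Qed.

End distribution.

(** * Countability of the dyadic cubes and a measurable substitute for the oscillation *)

Section discretization.
Context {R : realType} {disp : measure_display} {X : measurableType disp}.
Variable mu : {measure set X -> \bar R}.

(* The integral depends on [x] through [f x] only, and is either constantly
   [+oo] or a Lipschitz function of [f x]. *)
Lemma measurable_integral_dist (f : X -> R) (B : set X) :
  measurable_fun setT f -> measurable B -> (mu B < +oo)%E ->
  measurable_fun setT (fun x => \int[mu]_(y in B) `|f x - f y|%:E)%E.
Proof.
move=> mf mB Boo.
pose Phi (u : R) := (\int[mu]_(y in B) `|u - f y|%:E)%E.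
suff mPhi : measurable_fun setT Phi by exact: (measurableT_comp mPhi mf).
have Phi0 u : (0 <= Phi u)%E by apply: integral_ge0 => y _; rewrite lee_fin.
have mdiff (u : R) : measurable_fun B (fun y => `|u - f y|%:E).
  apply/measurable_EFinP; apply: measurableT_comp => //.
  by apply: measurable_funB => //; exact: measurable_funTS.
have PhiS u u' : (Phi u <= `|u - u'|%:E * mu B + Phi u')%E.
  rewrite -integral_cst// -ge0_integralD//.
  apply: ge0_le_integral => //.
  - by apply: emeasurable_funD => //; exact: mdiff.
  - move=> y _; rewrite -EFinD lee_fin.
    have {1}-> : u - f y = (u - u') + (u' - f y) by ring.
    exact: ler_normD.
  - by move=> y _; rewrite lee_fin.
have Bfin : mu B \is a fin_num by rewrite ge0_fin_numE.
have fin (u : R) : (`|u|%:E * mu B < +oo)%E by apply: lte_mul_pinfty => //; rewrite lee_fin.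
have [P0|P0] := ltP (Phi 0) +oo%E; last first.
  have -> : Phi = cst +oo%E; last exact: measurable_cst.
  apply/funext => u /=; apply/eqP; rewrite eq_le leey/= leNgt; apply/negP => Pu.
  have := lte_add_pinfty (fin u) Pu; have := le_trans P0 (PhiS 0 u).
  by rewrite sub0r normrN leye_eq => /eqP ->.
have Pfin u : Phi u \is a fin_num.
  rewrite ge0_fin_numE//; apply: le_lt_trans (PhiS u 0) _.
  by rewrite lte_add_pinfty// subr0.
have -> : Phi = EFin \o (fine \o Phi) by apply/funext => u /=; rewrite fineK.
apply/measurable_EFinP; apply: continuous_measurable_fun => u.
apply/cvgrPdist_lt => e e0.
pose V := fine (mu B).
have V0 : 0 <= V by exact: fine_ge0.
have d0 : 0 < e / (V + 1) by rewrite divr_gt0// ltr_wpDl.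
apply/nbhs_ballP; exists (e / (V + 1)) => // u' /=; rewrite /ball/= => uu'.
have lip w w' : fine (Phi w) - fine (Phi w') <= `|w - w'| * V.
  by rewrite lerBlDr -lee_fin EFinD EFinM !fineK.
have : `|fine (Phi u) - fine (Phi u')| <= `|u - u'| * V.
  by rewrite ler_norml lip andbT lerNl opprB distrC lip.
move=> /le_lt_trans; apply; rewrite ltr_pdivlMr ?ltr_wpDl// in uu'.
by apply: le_lt_trans uu'; rewrite ler_wpM2l// lerDl.
Qed.

(** Otherwise a sequence of disjoint sets of measure at least [v] would fit inside [B], against
    countable additivity. *)
Lemma finite_set_disjoint_measure {I : Type} (D : set I) (F : I -> set X)
    (B : set X) (v : R) : 0 < v -> measurable B -> (mu B < +oo)%E ->
  (forall i, D i -> measurable (F i)) -> (forall i, D i -> F i `<=` B) ->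
  (forall i, D i -> (v%:E <= mu (F i))%E) ->
  (forall i j, D i -> D j -> i <> j -> F i `&` F j = set0) ->
  finite_set D.
Proof.
elim/Ppointed: I => I in D F *.
  by rewrite emptyE => *; exact: finite_set0.
move=> v0 mB Boo mF FB vF dF; apply: contrapT => /infiniteP /pcard_leP[g].
have Dg n : D (g n) by exact: funS.
have mG n : measurable (F (g n)) by exact: mF.
have tG : trivIset setT (F \o g).
  move=> i j _ _ [y [/= yi yj]]; apply: contrapT => ij.
  have gij : g i <> g j by move=> /inj gE; apply: ij; apply: gE; rewrite inE.
  by have : (F (g i) `&` F (g j)) y by []; rewrite dF.
have UE := measure_bigcup mu setT (F \o g) (fun n _ => mG n) tG.
have : (\sum_(i <oo | i \in [set: nat]) mu ((F \o g) i) <= mu B)%E.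
  rewrite -UE; apply: le_measure; rewrite ?inE//; first by apply: bigcup_measurable => n _; exact: mG.
  by move=> y [n _ Fy]; exact: (FB (g n)).
apply/negP; rewrite -ltNge.
have Bfin : mu B \is a fin_num by rewrite ge0_fin_numE.
set M := fine (mu B).
pose n := (Num.truncn (M / v)).+1.
have nM : M < v * n%:R.
  by have := truncnS_gt (M / v); rewrite -/n ltr_pdivrMr// mulrC.
rewrite -(fineK Bfin); apply: (@lt_le_trans _ _ (v * n%:R)%:E); first by rewrite lte_fin.
apply: le_trans (nneseries_lim_ge n _) => //.
apply: (@le_trans _ _ (\sum_(0 <= i < n | i \in [set: nat]) v%:E)%E).
  rewrite sumEFin lee_fin big_mkcond/= (eq_bigr (fun=> v)); last by move=> i _; rewrite mem_setT.
  by rewrite sumr_const_nat subn0 mulr_natr.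
by apply: lee_sum => i _; exact: vF.
Qed.

Variables (dist : X -> X -> R) (A0 Cmu : R).
Hypothesis hX : homogeneous_space mu dist A0 Cmu.
Context {I : Type}.
Variables (delta c0 C0 : R) (A : int -> set I) (z : int -> I -> X).
Variable cube : int -> I -> set X.
Hypothesis hD : dyadic_system dist delta A z cube A0 c0 C0.

Local Notation qball := (qball dist).
Local Notation vol := (vol mu dist).

Let hd : quasi_metric dist A0 := homogeneous_quasi_metric hX.

Lemma delta_le : delta <= (4 * A0 ^+ 2)^-1.
Proof.
have A01 := quasi_metric_const_ge1 hd.
apply: le_trans (dyadic_delta_le hD) _.
have A2 : 1 <= 2 * A0 by lra.
have -> : 4 * A0 ^+ 2 = (2 * A0) ^+ 2 by ring.
by rewrite lef_pV2 ?posrE ?exprn_gt0 ?ler_weXn2l//; lra.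
Qed.

Lemma delta_lt1 : delta < 1.
Proof.
have A01 := quasi_metric_const_ge1 hd.
have A2 : 1 <= A0 ^+ 2 by rewrite exprn_ege1.
by apply: le_lt_trans delta_le _; rewrite invf_lt1; lra.
Qed.

(** The inner balls of distinct cubes are disjoint. Among centres at distance less than [n] from
    [x0], their measures have a common positive lower bound and they lie in one ball, so there are
    finitely many for each [n]. *)
Lemma countable_dyadic (x0 : X) k : countable (A k).
Proof.
have A01 := quasi_metric_const_ge1 hd; have A00 := A0_gt0 hX.
have dk0 : 0 < delta ^ k by rewrite exprz_gt0// (dyadic_delta_gt0 hD).
set r := (3 * A0 ^+ 2)^-1 * c0 * delta ^ k.
have r0 : 0 < r.
  by rewrite !mulr_gt0 ?(dyadic_c0_gt0 hD)// invr_gt0 mulr_gt0// exprn_gt0.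
pose An n := [set a | A k a /\ dist x0 (z k a) < n%:R].
have -> : A k = \bigcup_(n in [set: nat]) An n.
  apply/seteqP; split=> [a Aa|a [n _ []]//].
  by exists (Num.truncn (dist x0 (z k a))).+1 => //; split => //; exact: truncnS_gt.
apply: bigcup_countable => // n _; apply: finite_set_countable.
pose b := n%:R / r + 1.
have b0 : 0 < b by rewrite ltr_wpDl// divr_ge0// ltW.
have [L L1 LP] := vol_near hX b0.
have br0 : 0 < b * r by rewrite mulr_gt0.
have L0 : 0 < L by lra.
have rho0 : 0 < A0 * (n%:R + r) by rewrite mulr_gt0// ltr_wpDl.
apply: (@finite_set_disjoint_measure I (An n) (fun a => qball (z k a) r)
  (qball x0 (A0 * (n%:R + r))) (vol x0 (b * r) / L)).
- by rewrite divr_gt0// (vol_gt0 hX).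
- exact: (measurable_qball hX).
- by rewrite (mu_qball hX)// ltry.
- by move=> a _; exact: (measurable_qball hX).
- move=> a [_ xa]; apply: (qball_subset hX).
  by rewrite (quasi_metric_sym hd) ler_pM2l// lerD2r ltW.
- move=> a [_ xa]; rewrite (mu_qball hX)// lee_fin ler_pdivrMr// [leRHS]mulrC LP//.
  by rewrite /b mulrDl divfK ?gt_eqF// mul1r; lra.
- move=> a a' [Aa _] [Aa' _] aa'; apply/seteqP; split => // y [ya ya'].
  rewrite -(dyadic_disjoint hD Aa Aa' aa'); split; exact: (dyadic_inner hD).
Qed.

Variable Ct : R.
Hypothesis Ct_gt0 : 0 < Ct.

Local Notation oscillation := (oscillation mu dist delta Ct).

(* [oscillation f ^~ k] itself may fail to be measurable, since [dist] is not
   assumed to be jointly measurable. Replacing its ball by one that depends only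
   on the small dyadic cube containing [x] restores measurability. *)
Lemma measurable_oscillation (x0 : X) :
  exists2 C : R, 0 < C & forall f : X -> R, measurable_fun setT f ->
  exists m : int -> X -> \bar R,
    [/\ forall k x, (0 <= m k x)%E,
        forall k, measurable_fun setT (m k),
        forall k x, (oscillation f x k <= C%:E * m k x)%E &
        forall k x, (m k x <= C%:E * oscillation f x (k - 1))%E].
Proof.
have A01 := quasi_metric_const_ge1 hd; have A00 := A0_gt0 hX.
have d0 := dyadic_delta_gt0 hD; have d1 := delta_lt1.
have C00 : 0 < C0 := lt_le_trans (dyadic_c0_gt0 hD) (dyadic_c0_le hD).
have t1 : 1 < delta^-1 by rewrite invf_gt1.
have t0 : 0 < delta^-1 by rewrite invr_gt0.
(* [N] makes cubes of generation [k - 1 + N] so small that their points lie within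
   [Ct delta^(k-1) / (4 A0^2)] of the centre. *)
have [N NP] := exists_exprn_gt (2 * A0 * C0 * (4 * A0 ^+ 2) / Ct) t1.
have A20 : 0 < 4 * A0 ^+ 2 by rewrite mulr_gt0// exprn_gt0.
have NP' : 2 * A0 * C0 * delta ^+ N <= Ct / (4 * A0 ^+ 2).
  rewrite ler_pdivlMr// mulrAC.
  move: NP; rewrite exprVn ltr_pdivrMr// [ltRHS]mulrC ltr_pdivlMr ?exprn_gt0//.
  exact: ltW.
pose l (k : int) : int := k - 1 + N%:Z.
have dl k : delta ^ l k = delta ^ (k - 1) * delta ^+ N.
  by rewrite /l expfzDr ?gt_eqF.
have dpos (k : int) : 0 < delta ^ k by rewrite exprz_gt0.
have ex (kx : int * X) : exists a, A (l kx.1) a /\ cube (l kx.1) a kx.2.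
  have : [set: X] kx.2 by []; rewrite -(dyadic_cover hD (l kx.1)).
  by case=> a Aa ax; exists a.
have [al alP] := choice ex.
have alE k x a : A (l k) a -> cube (l k) a x -> al (k, x) = a.
  move=> Aa ax; apply: contrapT => ne; have [/= Aal alx] := alP (k, x).
  by have : (cube (l k) (al (k, x)) `&` cube (l k) a) x by []; rewrite (dyadic_disjoint hD).
(* This radius fits between two oscillation balls: with [p] the centre of the small cube containing
   [x], the ball of radius [r k] about [p] contains that of radius [Ct delta^k] about [x], by
   [delta_le], and is contained in that of radius [Ct delta^(k-1)]. *)
pose r (k : int) := Ct * delta ^ (k - 1) / (2 * A0).
have r0 k : 0 < r k by rewrite divr_gt0 ?mulr_gt0.
pose p k x := z (l k) (al (k, x)).
have near k x : dist (p k x) x < Ct * delta ^ (k - 1) / (4 * A0 ^+ 2).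
  have [/= Aa ax] := alP (k, x).
  apply: lt_le_trans (dyadic_outer hD Aa ax) _; rewrite dl.
  have := ler_wpM2r (ltW (dpos (k - 1))) NP'.
  by rewrite -!mulrA [delta ^+ N * _]mulrC [(4 * _)^-1 * _]mulrC.
have dk k : delta ^ k = delta * delta ^ (k - 1).
  by rewrite -[in RHS](expr1z delta) -expfzDr ?gt_eqF// addrC subrK.
have c10 : 0 < delta^-1 by [].
have [L1 L11 L1P] := vol_near hX c10.
have c20 : 0 < 2 * A0 by rewrite mulr_gt0.
have [L2 L21 L2P] := vol_near hX c20.
have L10 : 0 < L1 by lra.
have L20 : 0 < L2 by lra.
exists (L1 + L2); first by rewrite addr_gt0.
move=> f mf.
have mdiff x D : measurable_fun D (fun y => `|f x - f y|%:E).
  apply/measurable_EFinP; apply: measurableT_comp => //.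
  by apply: measurable_funB => //; exact: measurable_funTS.
pose Int (B : set X) x := (\int[mu]_(y in B) `|f x - f y|%:E)%E.
have Int0 B x : (0 <= Int B x)%E by apply: integral_ge0 => y _; rewrite lee_fin.
have IntS B B' x : measurable B -> measurable B' -> B `<=` B' -> (Int B x <= Int B' x)%E.
  by move=> mB mB' BB'; apply: ge0_subset_integral.
exists (fun k x => (vol (p k x) (r k))^-1%:E * Int (qball (p k x) (r k)) x)%E.
have mq x u : 0 < u -> measurable (qball x u) by exact: (measurable_qball hX).
have compare L (B B' : set X) (v v' : R) x : 0 < v -> 0 < v' -> 0 < L -> v' <= L * v ->
    measurable B -> measurable B' -> B `<=` B' ->
    (v^-1%:E * Int B x <= L%:E * (v'^-1%:E * Int B' x))%E.
  move=> v0 v'0 L0 vv' mB mB' BB'; rewrite muleA -EFinM.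
  apply: lee_pmul => //; first by rewrite lee_fin invr_ge0 ltW.
    by rewrite lee_fin ler_pdivlMr// mulrC ler_pdivrMr//.
  exact: IntS.
have widen (L : R) (e : \bar R) : 0 < L -> L <= L1 + L2 -> (0 <= e)%E ->
    (L%:E * e <= (L1 + L2)%:E * e)%E.
  by move=> _ LL e0; rewrite lee_wpmul2r// lee_fin.
split.
- by move=> k x; rewrite mule_ge0// lee_fin invr_ge0 vol_ge0.
- move=> k.
  have /countable_injP[g ginj] := countable_dyadic x0 (l k).
  have [a0 Aa0 _] := dyadic_net hD (l k) x0.
  (* [e] enumerates the cubes by inverting the injection [g], with [a0] as default outside its
     range. On each cube the centre is constant, so measurability follows piece by piece. *)
  have exe (n : nat) : exists a, A (l k) a /\ ((exists2 b, A (l k) b & g b = n) -> g a = n).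
    have [[b Ab gb]|nb] := pselect (exists2 b, A (l k) b & g b = n).
      by exists b.
    by exists a0; split => // /nb.
  have [e eP] := choice exe.
  have -> : [set: X] = \bigcup_n cube (l k) (e n).
    apply/seteqP; split => // x _; have [/= Aa ax] := alP (k, x).
    exists (g (al (k, x))) => //.
    have [Ae /(_ (ex_intro2 _ _ _ Aa erefl)) ge] := eP (g (al (k, x))).
    by rewrite (ginj _ _ _ _ ge) ?inE.
  apply/measurable_fun_bigcup => [n|n]; first exact: (dyadic_measurable hD (eP n).1).
  have Ae := (eP n).1.
  apply: (eq_measurable_fun (fun x => (vol (z (l k) (e n)) (r k))^-1%:E *
      Int (qball (z (l k) (e n)) (r k)) x)%E).
    by move=> x /[!inE] ex'; rewrite /p (alE k x (e n)).
  apply: measurable_funTS; apply: measurable_funeM.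
  apply: measurable_integral_dist => //; first exact: mq.
  by rewrite (mu_qball hX)// ltry.
- move=> k x.
  have rk0 : 0 < Ct * delta ^ k by rewrite mulr_gt0.
  apply: (@le_trans _ _ (L1%:E * ((vol (p k x) (r k))^-1%:E * Int (qball (p k x) (r k)) x))%E).
    apply: compare => //; rewrite ?(vol_gt0 hX)//.
    + have e : delta^-1 * (Ct * delta ^ k) = Ct * delta ^ (k - 1).
        by rewrite dk mulrCA mulKf ?gt_eqF.
      apply: (@le_trans _ _ (vol (p k x) (delta^-1 * (Ct * delta ^ k)))).
        rewrite e (vol_nondecreasing hX)// /r ler_pdivrMr// ler_peMr ?mulr_ge0 ?(ltW (dpos _)) ?(ltW Ct_gt0)//; lra.
      apply: L1P => //; rewrite e; apply: le_trans (ltW (near k x)) _.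
      rewrite ler_pdivrMr// ler_peMr ?mulr_ge0 ?(ltW (dpos _)) ?(ltW Ct_gt0)//.
      by have : 1 <= A0 ^+ 2 by [rewrite exprn_ege1]; lra.
    + exact: mq.
    + exact: mq.
    + apply: (qball_subset hX); rewrite (quasi_metric_sym hd).
      have h1 := near k x.
      have h2 : Ct * delta ^ k <= Ct * delta ^ (k - 1) / (4 * A0 ^+ 2).
        rewrite dk mulrCA mulrC ler_wpM2l ?delta_le// mulr_ge0 ?(ltW Ct_gt0) ?(ltW (dpos _))//.
      apply: (@le_trans _ _ (A0 * (Ct * delta ^ (k - 1) / (4 * A0 ^+ 2) + Ct * delta ^ (k - 1) / (4 * A0 ^+ 2)))).
        by rewrite ler_pM2l// lerD// ltW.
      rewrite le_eqVlt; apply/orP; left; apply/eqP; rewrite /r; field.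
      exact: lt0r_neq0.
  by apply: widen => //; [lra|rewrite mule_ge0// lee_fin invr_ge0 vol_ge0].
move=> k x.
have rk0 : 0 < Ct * delta ^ (k - 1) by rewrite mulr_gt0.
apply: (@le_trans _ _ (L2%:E * ((vol x (Ct * delta ^ (k - 1)))^-1%:E * Int (qball x (Ct * delta ^ (k - 1))) x))%E); last first.
  by apply: widen => //; [lra|rewrite mule_ge0// lee_fin invr_ge0 vol_ge0].
have e : 2 * A0 * r k = Ct * delta ^ (k - 1) by rewrite /r mulrC divfK// gt_eqF.
have q1 : 1 <= 4 * A0 ^+ 2.
  by have : 1 <= A0 ^+ 2 by [rewrite exprn_ege1]; lra.
apply: compare => //; rewrite ?(vol_gt0 hX)//.
- rewrite -e; apply: L2P => //; rewrite e (quasi_metric_sym hd).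
  apply: le_trans (ltW (near k x)) _.
  by rewrite ler_pdivrMr// ler_peMr// ltW.
- exact: mq.
- exact: mq.
apply: (qball_subset hX).
apply: (@le_trans _ _ (A0 * (Ct * delta ^ (k - 1) / (4 * A0 ^+ 2) + r k))).
  by rewrite ler_pM2l// lerD2r ltW.
have -> : A0 * (Ct * delta ^ (k - 1) / (4 * A0 ^+ 2) + r k) =
    Ct * delta ^ (k - 1) * ((4 * A0)^-1 + 2^-1).
  by rewrite /r; field; exact: lt0r_neq0.
rewrite ler_piMr ?(ltW rk0)//.
have : (4 * A0)^-1 <= 4^-1 by rewrite lef_pV2 ?posrE ?mulr_gt0//; lra.
lra.
Qed.

End discretization.

(** * The two inclusions *)

Section inclusions.
Context {R : realType} {disp : measure_display} {X : measurableType disp}.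
Variables (mu : {measure set X -> \bar R}) (dist : X -> X -> R) (A0 Cmu : R).
Hypothesis hX : homogeneous_space mu dist A0 Cmu.
Hypothesis mu_infinite : (mu [set: X] = +oo)%E.
Context {I : Type}.
Variables (delta c0 C0 : R) (A : int -> set I) (z : int -> I -> X).
Variable cube : int -> I -> set X.
Hypothesis hD : dyadic_system dist delta A z cube A0 c0 C0.
Variables (x0 : X) (r0 Ct : R).
Hypotheses (r0_gt0 : 0 < r0) (Ct_gt0 : 0 < Ct).
Variables (eta : R) (Q : int -> X -> X -> R).
Hypothesis hQ : exp_ATI mu dist delta A z eta Q.
Variables (beta gamma s : R).
Hypotheses (s_gt0 : 0 < s) (s_lt : s < gamma).

Local Notation oscillation := (oscillation mu dist delta Ct).
Local Notation wlq_norm := (wlq_norm delta s).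

Let d0 : 0 < delta := dyadic_delta_gt0 hD.
Let d1 : delta < 1 := delta_lt1 hX hD.

Let phi (f : X -> R) (g : X -> R) : R := \int[mu]_x (f x * g x).

Lemma distribution_of_oscillation (f : X -> R) (K : R) :
  measurable_fun setT f -> 0 < K ->
  (forall (k : int) B, measurable B -> qball dist x0 r0 `<=` B ->
     exists2 x, B x & (oscillation f x k <= (K * delta `^ (k%:~R * s))%:E)%E) ->
  (forall g, test_closure mu dist A0 x0 r0 eta beta gamma g ->
     mu.-integrable setT (fun x => (f x * g x)%:E)) /\
  distribution_space mu dist A0 x0 r0 eta beta gamma (phi f).
Proof.
move=> mf K0 H.
have [e [W [W0 hW]]] :=
  lower_integral_oscillation hX d0 d1 Ct_gt0 r0_gt0 s_gt0 s_lt mf K0 H.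
exact: (distribution_of_lower_integral hX d0 d1 r0_gt0 s_gt0 s_lt eta beta mf W0 hW).
Qed.

Lemma vol_le_mu B : measurable B -> qball dist x0 r0 `<=` B ->
  ((vol mu dist x0 r0)%:E <= mu B)%E.
Proof.
move=> mB sB; rewrite -(mu_qball hX)//; apply: le_measure; rewrite ?inE//.
exact: (measurable_qball hX).
Qed.

Lemma le_delta_powR (k : int) (K : R) (e : \bar R) :
  ((delta `^ (- (k%:~R * s)))%:E * e <= K%:E)%E ->
  (e <= (K * delta `^ (k%:~R * s))%:E)%E.
Proof.
by rewrite powRN lee_pdivrMl ?powR_gt0// -EFinM mulrC.
Qed.

Lemma lipschitz_b_besov (p q : \bar R) : (0 < p)%E -> (0 < q)%E ->
  lipschitz_b mu dist delta Ct s p q `<=`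
  funs_in mu dist A0 x0 r0 eta beta gamma
    (besov mu dist A0 delta x0 r0 eta beta gamma Q s p q).
Proof.
move=> p0 q0 f [[mf _]].
pose O k := Lnorm mu p (fun x => oscillation f x k).
have O0 k : (0 <= O k)%E by exact: Lnorm_ge0.
rewrite -/O => Ofin.
have osc0 x k : (0 <= oscillation f x k)%E by exact: oscillation_ge0.
have w0 := wlq_norm_ge0 delta s q O0.
have wfin : wlq_norm q O \is a fin_num by rewrite ge0_fin_numE.
pose N := fine (wlq_norm q O) + 1.
have N0 : 0 < N by rewrite ltr_wpDl// fine_ge0.
have wN : (wlq_norm q O <= N%:E)%E by rewrite -(fineK wfin) lee_fin lerDl.
(* Every set [B] that occurs contains the ball of radius [r0] about [x0], so one constant [K] serves
   for all scales. *)
have [K K0 KP] := exists_le_Lnorm mu p0 (vol_gt0 hX x0 r0_gt0).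
have [|k B mB sB|if1 if2] := @distribution_of_oscillation f (K * N) mf.
- by rewrite mulr_gt0.
- rewrite -mulrA; apply: KP => //; first by rewrite mulr_gt0 ?powR_gt0.
    exact: vol_le_mu.
  apply: le_delta_powR; apply: le_trans wN; exact: (le_wlq_norm _ _ _ q0 O0).
split => //; split => //; rewrite /besov_norm.
have sigma0 : 0 < delta `^ s / 2 by rewrite divr_gt0 ?powR_gt0.
have [rho rho0 rhoP] := Lnorm_tail_sup mu p0 sigma0.
have [C C1 CP] := pairing_le_oscillation hX d0 d1 Ct_gt0 hQ rho0.
have [c c1 /(_ f mf)[m [m0 mm oscm mosc]]] := measurable_oscillation hX hD Ct_gt0 x0.
have [C' C'0 C'P] := rhoP _ (mulr_gt0 C1 c1).
have [D D0 DP] := wlq_norm_tail_sup s d0 q0 C'0.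
(* The majorant [m k] is controlled by the oscillation at [k - 1], which is the term [j = 1] of
   [tail_sup]; hence the division by [delta^s / 2]. *)
have e0 : 0 < c / (delta `^ s / 2) by rewrite divr_gt0.
have [E E0 EP] := wlq_norm_tail_sup s d0 q0 e0.
pose M k := Lnorm mu p (m k).
have M0 k : (0 <= M k)%E by exact: Lnorm_ge0.
apply: (@le_lt_trans _ _ (D%:E * wlq_norm q M)%E).
  apply: DP => // k; first exact: Lnorm_ge0.
  apply: C'P => // x; first by rewrite lee_fin.
  apply: le_trans (CP f k x mf) _; apply: lee_nneseries => j _.
    by rewrite mule_ge0// lee_fin mulr_ge0 ?exprn_ge0 ?(ltW C1) ?(ltW rho0).
  rewrite mulrAC [in leRHS]EFinM -muleA lee_wpmul2l ?oscm// lee_fin.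
  by rewrite mulr_ge0 ?exprn_ge0 ?(ltW C1) ?(ltW rho0).
apply: lte_mul_pinfty; rewrite ?lee_fin ?(ltW D0)//.
apply: (@le_lt_trans _ _ (E%:E * wlq_norm q O)%E); last first.
  by apply: lte_mul_pinfty; rewrite ?lee_fin ?(ltW E0).
apply: EP => // k; apply: (@le_trans _ _ (c%:E * O (k - 1)%R)%E).
  by apply: le_Lnorm => //.
rewrite EFinM -muleA lee_wpmul2l ?lee_fin ?(ltW c1)// lee_pdivlMl//.
exact: (tail_sup_ge _ O k 1).
Qed.

Lemma wlq_norm_pairing (q : \bar R) : (0 < q)%E ->
  exists2 C : R, 0 < C & forall (f : X -> R) x, measurable_fun setT f ->
  (wlq_norm q (abs_LP Q (phi f) x) <= C%:E * wlq_norm q (oscillation f x))%E.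
Proof.
move=> q0.
have sigma0 : 0 < delta `^ s / 2 by rewrite divr_gt0 ?powR_gt0.
(* Half the target rate, because passing from the series to [tail_sup] doubles it. *)
have rho0 : 0 < delta `^ s / 2 / 2 by rewrite divr_gt0.
have [C C1 CP] := pairing_le_oscillation hX d0 d1 Ct_gt0 hQ rho0.
have C20 : 0 < 2 * C by rewrite mulr_gt0.
have [D D0 DP] := wlq_norm_tail_sup s d0 q0 C20.
exists D => // f x mf; apply: DP => k; first by rewrite lee_fin.
  exact: oscillation_ge0.
apply: le_trans (CP f k x mf) _.
apply: le_trans (nneseries_le_tail_sup _ _ _ _) _; rewrite ?(ltW rho0) ?(ltW C1)//.
  by move=> i; exact: oscillation_ge0.
by rewrite [(2 * (_ / 2))%R]mulrC divfK.
Qed.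

Lemma cube_measure k a : A k a ->
  [/\ measurable (cube k a), 0 < fine (mu (cube k a)) &
      mu (cube k a) = (fine (mu (cube k a)))%:E].
Proof.
move=> Aa; have mc := dyadic_measurable hD Aa.
have dk0 : 0 < delta ^ k by rewrite exprz_gt0.
have A00 := A0_gt0 hX; have c00 := dyadic_c0_gt0 hD.
have C00 : 0 < C0 := lt_le_trans c00 (dyadic_c0_le hD).
have r1 : 0 < (3 * A0 ^+ 2)^-1 * c0 * delta ^ k.
  by rewrite !mulr_gt0// invr_gt0 mulr_gt0// exprn_gt0.
have r2 : 0 < 2 * A0 * C0 * delta ^ k by rewrite !mulr_gt0.
have b1 : (mu (qball dist (z k a) ((3 * A0 ^+ 2)^-1 * c0 * delta ^ k)) <= mu (cube k a))%E.
  apply: le_measure; rewrite ?inE//; first exact: (measurable_qball hX).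
  exact: (dyadic_inner hD).
have b2 : (mu (cube k a) <= mu (qball dist (z k a) (2 * A0 * C0 * delta ^ k)))%E.
  apply: le_measure; rewrite ?inE//; first exact: (measurable_qball hX).
  exact: (dyadic_outer hD).
have fin : mu (cube k a) \is a fin_num.
  by rewrite ge0_fin_numE//; apply: le_lt_trans b2 _; rewrite (mu_qball hX)// ltry.
split => //; last by rewrite fineK.
rewrite -lte_fin fineK//; apply: lt_le_trans b1.
by rewrite (mu_qball hX)// lte_fin (vol_gt0 hX).
Qed.

(** For finite [q] the mean over a cube of a function a.e. at most [M^q] is at most [M^q], and
    restricting to [k >= l] only decreases the sum. For [q = +oo] the same restriction decreases the
    supremum. *)
Lemma local_F_norm_le (psi : (X -> R) -> R) (q : \bar R) (M : R) k a :
  (0 < q)%E -> 0 <= M -> A k a ->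
  (\forall x \ae mu, (wlq_norm q (abs_LP Q psi x) <= M%:E)%E) ->
  (local_F_norm mu delta cube Q s q psi k a <= M%:E)%E.
Proof.
move=> q0 M0 Aa aeM; have [mc c_gt0 cE] := cube_measure Aa.
have abs0 x j : (0 <= abs_LP Q psi x j)%E by rewrite lee_fin.
case: q q0 aeM => [r|_|//] => [|aeM]; rewrite /local_F_norm; last first.
  apply/ess_supP; apply: filterS aeM => x xM; rewrite /patch.
  case: ifPn => _; last by rewrite lee_fin.
  by apply: le_trans xM; apply: ereal_sup_le => _ [j _ <-]; exists j.
rewrite lte_fin => r_gt0 aeM.
have MK : M%:E = ((M%:E `^ r) `^ r^-1)%E by rewrite poweRK.
rewrite {}MK; apply: lee_poweR; first by rewrite invr_gt0.
  rewrite mule_ge0 ?lee_fin ?invr_ge0 ?(ltW c_gt0)//.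
  by apply: integral_ge0 => x _; exact: wlq_sum_ge0.
rewrite lee_pdivrMl// muleC -cE; apply: ae_lower_integral_le => //.
- exact: poweR_ge0.
- by move=> x _; exact: wlq_sum_ge0.
apply: filterS aeM => x xM _.
apply: (@le_trans _ _ (wlq_sum delta s r setT (abs_LP Q psi x))).
  by apply: ereal_sup_le => _ [Y [fY YS] <-]; exists Y.
rewrite -[leLHS](poweRVK r_gt0) ?wlq_sum_ge0//.
by apply: lee_poweR => //; exact: poweR_ge0.
Qed.

Lemma lipschitz_t_triebel_lizorkin (p q : \bar R) : (0 < p)%E -> (0 < q)%E ->
  lipschitz_t mu dist delta Ct s p q `<=`
  funs_in mu dist A0 x0 r0 eta beta gamma
    (triebel_lizorkin mu dist A0 delta A cube x0 r0 eta beta gamma Q s p q).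
Proof.
move=> p0 q0 f [[mf _]].
pose O x := wlq_norm q (oscillation f x).
have osc0 x k : (0 <= oscillation f x k)%E by exact: oscillation_ge0.
have O0 x : (0 <= O x)%E by exact: wlq_norm_ge0.
rewrite -/O => Ofin.
have w0 : (0 <= Lnorm mu p O)%E by exact: Lnorm_ge0.
have wfin : Lnorm mu p O \is a fin_num by rewrite ge0_fin_numE.
pose N := fine (Lnorm mu p O) + 1.
have N0 : 0 < N by rewrite ltr_wpDl// fine_ge0.
have wN : (Lnorm mu p O <= N%:E)%E by rewrite -(fineK wfin) lee_fin lerDl.
have [K K0 KP] := exists_le_Lnorm mu p0 (vol_gt0 hX x0 r0_gt0).
have [|k B mB sB|if1 if2] := @distribution_of_oscillation f (K * N) mf.
- by rewrite mulr_gt0.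
- have [x Bx xN] := KP N O B N0 O0 mB (vol_le_mu mB sB) wN.
  exists x => //; apply: le_delta_powR; apply: le_trans xN.
  exact: le_wlq_norm.
split => //; split => //; rewrite /triebel_lizorkin_norm.
have [C C1 CP] := wlq_norm_pairing q0.
have abs0 x j : (0 <= abs_LP Q (phi f) x j)%E by rewrite lee_fin.
case: ifPn => [/eqP pE|_]; last first.
  apply: (@le_lt_trans _ _ (C%:E * Lnorm mu p O)%E).
    apply: le_Lnorm => // x; first exact: wlq_norm_ge0.
    exact: CP.
  by apply: lte_mul_pinfty; rewrite ?lee_fin ?(ltW C1).
apply: (@le_lt_trans _ _ (C * N)%:E); last exact: ltry.
apply: ge_ereal_sup => _ [[k a] /= Aa <-].
apply: local_F_norm_le => //; first by rewrite mulr_ge0 ?ltW.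
(* [Lnorm] at [+oo] is the essential supremum once the space has positive measure, and 0 otherwise;
   the infinite measure selects the first case. *)
move: wN; rewrite pE unlock mu_infinite ltry => /ess_supP.
apply: filterS => x /=; rewrite gee0_abs// => xN.
apply: le_trans (CP f x mf) _.
by rewrite EFinM lee_wpmul2l// lee_fin ltW.
Qed.

End inclusions.

Theorem proposition4p1
  (R : realType) (disp : measure_display) (X : measurableType disp)
  (mu : {measure set X -> \bar R}) (dist : X -> X -> R) (A0 Cmu : R)
  (hX : homogeneous_space mu dist A0 Cmu)
  (mu_infinite : (mu [set: X] = +oo)%E)
  (I : Type) (delta c0 C0 : R)
  (A : int -> set I) (z : int -> I -> X) (cube : int -> I -> set X)
  (hD : dyadic_system dist delta A z cube A0 c0 C0)
  (x0 : X) (r0 : R) (r0_gt0 : 0 < r0)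
  (Ct : R) (Ct_gt0 : 0 < Ct)
  (eta : R) (eta_gt0 : 0 < eta) (eta_lt1 : eta < 1)
  (Q : int -> X -> X -> R) (hQ : exp_ATI mu dist delta A z eta Q)
  (beta gamma : R) (beta_gt0 : 0 < beta) (beta_lt : beta < eta)
  (gamma_gt0 : 0 < gamma) (gamma_lt : gamma < eta)
  (s : R) (s_gt0 : 0 < s) (s_lt : s < Num.min beta gamma) :
  let omega := upper_dim Cmu in
  let p0 := omega / (omega + Num.min beta gamma) in
  (forall p q : \bar R, (p0%:E < p)%E -> (0 < q)%E ->
     lipschitz_b mu dist delta Ct s p q `<=`
     funs_in mu dist A0 x0 r0 eta beta gamma
       (besov mu dist A0 delta x0 r0 eta beta gamma Q s p q)) /\
  (forall p q : \bar R, (p0%:E < p)%E -> (p0%:E < q)%E ->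
     lipschitz_t mu dist delta Ct s p q `<=`
     funs_in mu dist A0 x0 r0 eta beta gamma
       (triebel_lizorkin mu dist A0 delta A cube x0 r0 eta beta gamma Q s p q)).
Proof.
move=> omega p0.
have s_lt_gamma : s < gamma by move: s_lt; rewrite lt_min => /andP[].
have omega_ge0 : 0 <= omega.
  rewrite /omega /upper_dim divr_ge0// ln_ge0 ?(homogeneous_const_ge1 hX)//.
  by rewrite ler1n.
have p0_ge0 : 0 <= p0.
  by rewrite divr_ge0// addr_ge0// le_min !ltW.
have pos (p : \bar R) : (p0%:E < p -> 0 < p)%E by apply: le_lt_trans; rewrite lee_fin.
split=> p q /pos p_gt0 => [q_gt0|/pos q_gt0].
- exact: (lipschitz_b_besov hX hD x0 r0_gt0 Ct_gt0 hQ beta s_gt0 s_lt_gamma).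
- exact: (lipschitz_t_triebel_lizorkin hX mu_infinite hD x0 r0_gt0 Ct_gt0 hQ beta s_gt0 s_lt_gamma).
Qed.
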